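(* Let $(M,\varphi,\xi,\eta,g)$ be a $3$-dimensional $\mathcal F_1$-manifold with Lee form $\theta$, let $C(t)$ be a slant null curve on $M$ with $\eta(\dot C)=a$, where $a\neq0$ is a real constant, and suppose that $b=g(\dot C,\varphi\dot C)$ satisfies the ordinary differential equation $$\dot C(b)=b\,\theta(\varphi\dot C)-a^2\theta(\dot C)+\frac2a\sqrt{a^4+b^2}.$$ Then $(C(t),\mathbf F_1)$ is a non-geodesic Cartan framed slant null curve (with respect to the original parameter $t$), where $\mathbf F_1=\{\dot C,N_1,W_1\}$ is the unique general Frenet frame along $C(t)$, with the same orientation as $\{\dot C,\xi,\varphi\dot C\}$, for which $t$ is distinguished, namely $$W_1=\alpha\xi-\frac{\alpha}{a}\dot C+\gamma\varphi\dot C,\qquad N_1=\frac1a\xi-\frac1{2a^2}\dot C,\qquad \alpha=-\frac{b}{\sqrt{a^4+b^2}},\quad \gamma=\frac{a}{\sqrt{a^4+b^2}}.$$ Moreover, the torsion function is $\tau=-\frac{1}{2a^2}$. In particular, if $(M,\varphi,\xi,\eta,g)$ is an $\mathcal F_0$-manifold, then $b$ is given by $$b=\frac12\left[\exp\left(\frac{2(t+u)}{a}\right)-a^4\exp\left(-\frac{2(t+u)}{a}\right)\right],$$ where $u$ is an arbitrary real constant.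
   Context: A $3$-dimensional almost contact B-metric manifold $(M,\varphi,\xi,\eta,g)$ is a $3$-dimensional smooth manifold $M$ with an endomorphism field $\varphi$ of $TM$, a vector field $\xi$ (Reeb vector field), a $1$-form $\eta$ and a pseudo-Riemannian metric $g$ such that $\varphi^2=-\mathrm{id}+\eta\otimes\xi$, $\eta(\xi)=1$ and $g(\varphi X,\varphi Y)=-g(X,Y)+\eta(X)\eta(Y)$. Consequently $\eta\circ\varphi=0$, $\varphi\xi=0$, $\eta(X)=g(X,\xi)$, $g(\xi,\xi)=1$, and $g$ has signature $(2,1)$. $\nabla$ is the Levi-Civita connection of $g$, $F(X,Y,Z)=g((\nabla_X\varphi)Y,Z)$, and the Lee form is $\theta(X)=\sum_{i,j=1}^{2}g^{ij}F(e_i,e_j,X)$, where $\{e_1,e_2,\xi\}$ is a basis of $T_xM$ with $e_1,e_2\in\ker\eta$ and $(g^{ij})$ is the inverse of $(g(e_i,e_j))$. $(M,\varphi,\xi,\eta,g)$ is an $\mathcal F_1$-manifold if $$F(X,Y,Z)=\tfrac12\{g(X,\varphi Y)\theta(\varphi Z)+g(\varphi X,\varphi Y)\theta(\varphi^2Z)+g(X,\varphi Z)\theta(\varphi Y)+g(\varphi X,\varphi Z)\theta(\varphi^2Y)\}.$$ (On such a manifold $\nabla\xi=0$.) It is an $\mathcal F_0$-manifold if $F=0$ (equivalently, an $\mathcal F_1$-manifold with $\theta=0$). A null curve is a smooth curve $C(t)$ with $\dot C\ne0$ and $g(\dot C,\dot C)=0$ everywhere. It is slant if $g(\dot C,\xi)=\eta(\dot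 C)=a$ is a real constant. $\dot C(f)$ denotes the derivative $df/dt$ of a function $f$ along $C$. A general Frenet frame along a null curve $C$ is a frame $\mathbf F=\{\dot C,N,W\}$ of vector fields along $C$ with $g(\dot C,N)=g(W,W)=1$ and $g(N,N)=g(N,W)=g(\dot C,W)=0$; the functions $h,k_1,k_2$ with respect to $\mathbf F$ are defined by $\nabla_{\dot C}\dot C=h\dot C+k_1W$, $\nabla_{\dot C}N=-hN+k_2W$, $\nabla_{\dot C}W=-k_2\dot C-k_1N$. The parameter $t$ is distinguished for $\mathbf F$ if $h\equiv0$. The curve is non-geodesic if $k_1$ is nowhere zero. A Frenet frame $\mathbf F$ is a Cartan Frenet frame with respect to $t$, and $(C(t),\mathbf F)$ is a Cartan framed null curve, if the Cartan Frenet equations $\nabla_{\dot C}\dot C=W$, $\nabla_{\dot C}N=\tau W$, $\nabla_{\dot C}W=-\tau\dot C-N$ hold (i.e. $h=0$, $k_1=1$); the function $\tau$ is the torsion function. *)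

(* Defs.v *)
From HB Require Import structures.
From mathcomp Require Import all_boot all_order all_algebra.
From mathcomp Require Import all_classical all_reals all_analysis.
Set Implicit Arguments.
Unset Strict Implicit.
Unset Printing Implicit Defensive.
Import Order.TTheory GRing.Theory Num.Theory.
Import numFieldNormedType.Exports.
Local Open Scope classical_set_scope.
Local Open Scope ring_scope.

(* Conventions.  All geometric objects are given by their components in every
   chart of an atlas.  Tangent vectors are row vectors, covectors are column
   vectors and linear maps act on the right, in agreement with the library's
   Jacobian ('d f x v = v *m 'J f x).  "For every chart i around p and all row
   vectors x, y, ..." thus means "for all tangent vectors at p". *)

(* Iterated Frechet differentiability; only meant for an open set U of a
   finite-dimensional space V, where continuity of the derivative is the same
   as continuity of x |-> 'd f x v for every v. *)
Fixpoint Ck {R : realType} {V W : normedModType R} (k : nat) (U : set V)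
    (f : V -> W) : Prop :=
  match k with
  | 0 => forall x, U x -> {for x, continuous f}
  | k'.+1 => (forall x, U x -> differentiable f x) /\
             (forall v, Ck k' U (fun x => 'd f x v))
  end.

Definition smooth_on {R : realType} {V W : normedModType R} (U : set V)
    (f : V -> W) : Prop := forall k, Ck k U f.

Record smooth_manifold (R : realType) (n : nat) := SmoothManifold {
  mcarrier :> topologicalType ;
  m_hausdorff : hausdorff_space mcarrier ;
  m_second_countable : @second_countable mcarrier ;
  midx : Type ;
  mdom : midx -> set mcarrier ;
  mchart : midx -> mcarrier -> 'rV[R]_n ;
  (* inverse of the chart; arbitrary outside the image of the chart *)
  mparam : midx -> 'rV[R]_n -> mcarrier ;
  m_cover : forall p, exists i, mdom i p ;
  m_dom_open : forall i, open (mdom i) ;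
  m_img_open : forall i, open (mchart i @` mdom i) ;
  m_chartK : forall i p, mdom i p -> mparam i (mchart i p) = p ;
  m_chart_cont : forall i p, mdom i p -> {for p, continuous (mchart i)} ;
  m_param_cont : forall i x, (mchart i @` mdom i) x ->
    {for x, continuous (mparam i)} ;
  m_smooth : forall i j,
    smooth_on (mchart i @` (mdom i `&` mdom j)) (mchart j \o mparam i) }.

(* Jacobian matrix at the point p of the change of coordinates from chart i to
   chart j: the components of a tangent vector satisfy x_j = x_i *m jac i j p. *)
Definition jac {R : realType} {n : nat} (M : smooth_manifold R n)
    (i j : midx M) (p : M) : 'M[R]_n :=
  'J (mchart j \o mparam i) (mchart i p).

Definition smooth_field {R : realType} {n : nat} (M : smooth_manifold R n)
    (T : normedModType R) (X : midx M -> M -> T) : Prop :=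
  forall i, smooth_on (mchart i @` mdom i) (X i \o mparam i).

Record vector_field (R : realType) (n : nat) (M : smooth_manifold R n) :=
  VectorField {
  vf_comp :> midx M -> M -> 'rV[R]_n ;
  vf_smooth : smooth_field vf_comp ;
  vf_change : forall i j p, mdom i p -> mdom j p ->
    vf_comp j p = vf_comp i p *m jac i j p }.

Record one_form (R : realType) (n : nat) (M : smooth_manifold R n) :=
  OneForm {
  of_comp :> midx M -> M -> 'cV[R]_n ;
  of_smooth : smooth_field of_comp ;
  of_change : forall i j p, mdom i p -> mdom j p ->
    of_comp i p = jac i j p *m of_comp j p }.

Record endo_field (R : realType) (n : nat) (M : smooth_manifold R n) :=
  EndoField {
  ef_comp :> midx M -> M -> 'M[R]_n ;
  ef_smooth : smooth_field ef_comp ;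
  ef_change : forall i j p, mdom i p -> mdom j p ->
    ef_comp i p *m jac i j p = jac i j p *m ef_comp j p }.

Record pseudo_metric (R : realType) (n : nat) (M : smooth_manifold R n) :=
  PseudoMetric {
  pm_comp :> midx M -> M -> 'M[R]_n ;
  pm_smooth : smooth_field pm_comp ;
  pm_change : forall i j p, mdom i p -> mdom j p ->
    pm_comp i p = jac i j p *m pm_comp j p *m (jac i j p)^T ;
  pm_sym : forall i p, mdom i p -> (pm_comp i p)^T = pm_comp i p ;
  pm_nondeg : forall i p, mdom i p -> pm_comp i p \in unitmx }.

Definition form1 {R : realType} {n : nat} (w : 'cV[R]_n) (x : 'rV[R]_n) : R :=
  (x *m w) 0 0.

Definition form2 {R : realType} {n : nat} (g : 'M[R]_n) (x y : 'rV[R]_n) : R :=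
  (x *m g *m y^T) 0 0.

(* Derivative at p of a field of components, in the chart i, in the direction
   of the tangent vector x. *)
Definition dir_der {R : realType} {n : nat} (M : smooth_manifold R n)
    (T : normedModType R) (X : midx M -> M -> T) (i : midx M) (p : M)
    (x : 'rV[R]_n) : T :=
  'D_x (X i \o mparam i) (mchart i p).

Definition chr_eval {R : realType} {n : nat} (G : 'I_n -> 'I_n -> 'rV[R]_n)
    (x y : 'rV[R]_n) : 'rV[R]_n :=
  \sum_(k < n) \sum_(l < n) (x 0 k * y 0 l) *: G k l.

(* [conn_comp i p k l] is the row vector of the Christoffel symbols
   Gamma_kl^m; [conn_change] says that nabla_X Y, with components
   dY(x) + Gamma(x, y), transforms as a vector field. *)
Record connection (R : realType) (n : nat) (M : smooth_manifold R n) :=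
  Connection {
  conn_comp :> midx M -> M -> 'I_n -> 'I_n -> 'rV[R]_n ;
  conn_smooth : forall k l, smooth_field (fun i p => conn_comp i p k l) ;
  conn_change : forall i j p (x y : 'rV[R]_n), mdom i p -> mdom j p ->
    chr_eval (conn_comp j p) (x *m jac i j p) (y *m jac i j p) =
    chr_eval (conn_comp i p) x y *m jac i j p -
    y *m 'D_x (fun z => 'J (mchart j \o mparam i) z) (mchart i p) }.

Definition torsion_free {R : realType} {n : nat} (M : smooth_manifold R n)
    (G : connection M) : Prop :=
  forall i p (x y : 'rV[R]_n), mdom i p ->
    chr_eval (G i p) x y = chr_eval (G i p) y x.

Definition metric_compatible {R : realType} {n : nat}
    (M : smooth_manifold R n) (g : pseudo_metric M) (G : connection M) : Prop :=
  forall i p (x y z : 'rV[R]_n), mdom i p ->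
    form2 (dir_der g i p x) y z =
    form2 (g i p) (chr_eval (G i p) x y) z +
    form2 (g i p) y (chr_eval (G i p) x z).

Definition levi_civita {R : realType} {n : nat} (M : smooth_manifold R n)
    (g : pseudo_metric M) (G : connection M) : Prop :=
  torsion_free G /\ metric_compatible g G.

(* (nabla_X phi) Y = nabla_X (phi Y) - phi (nabla_X Y), for the fields X, Y
   with constant components x, y in the chart i. *)
Definition nabla_endo {R : realType} {n : nat} (M : smooth_manifold R n)
    (G : connection M) (phi : endo_field M) (i : midx M) (p : M)
    (x y : 'rV[R]_n) : 'rV[R]_n :=
  y *m dir_der phi i p x + chr_eval (G i p) x (y *m phi i p)
  - chr_eval (G i p) x y *m phi i p.

Record acB_metric (R : realType) (M : smooth_manifold R 3) := AcBMetric {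
  ac_phi : endo_field M ;
  ac_xi : vector_field M ;
  ac_eta : one_form M ;
  ac_g : pseudo_metric M ;
  ac_phi2 : forall i p (x : 'rV[R]_3), mdom i p ->
    x *m ac_phi i p *m ac_phi i p =
    - x + form1 (ac_eta i p) x *: ac_xi i p ;
  ac_eta_xi : forall i p, mdom i p -> form1 (ac_eta i p) (ac_xi i p) = 1 ;
  ac_gphi : forall i p (x y : 'rV[R]_3), mdom i p ->
    form2 (ac_g i p) (x *m ac_phi i p) (y *m ac_phi i p) =
    - form2 (ac_g i p) x y + form1 (ac_eta i p) x * form1 (ac_eta i p) y }.

Definition acF {R : realType} {M : smooth_manifold R 3} (S : acB_metric M)
    (G : connection M) (i : midx M) (p : M) (x y z : 'rV[R]_3) : R :=
  form2 (ac_g S i p) (nabla_endo G (ac_phi S) i p x y) z.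

Definition lee_form {R : realType} {M : smooth_manifold R 3}
    (S : acB_metric M) (G : connection M) (theta : one_form M) : Prop :=
  forall i p (e : 'I_2 -> 'rV[R]_3) (x : 'rV[R]_3), mdom i p ->
    (forall k, form1 (ac_eta S i p) (e k) = 0) ->
    basis_of fullv [:: e ord0; e ord_max; ac_xi S i p] ->
    form1 (theta i p) x =
    \sum_(k < 2) \sum_(l < 2)
      invmx (\matrix_(k', l') form2 (ac_g S i p) (e k') (e l')) k l *
      acF S G i p (e k) (e l) x.

Definition F1_manifold {R : realType} {M : smooth_manifold R 3}
    (S : acB_metric M) (G : connection M) (theta : one_form M) : Prop :=
  forall i p (x y z : 'rV[R]_3), mdom i p ->
    let f := fun v : 'rV[R]_3 => v *m ac_phi S i p in
    let g := form2 (ac_g S i p) in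
    let th := form1 (theta i p) in
    acF S G i p x y z =
    2^-1 * (g x (f y) * th (f z) + g (f x) (f y) * th (f (f z)) +
            g x (f z) * th (f y) + g (f x) (f z) * th (f (f y))).

Definition F0_manifold {R : realType} {M : smooth_manifold R 3}
    (S : acB_metric M) (G : connection M) : Prop :=
  forall i p (x y z : 'rV[R]_3), mdom i p -> acF S G i p x y z = 0.

(* A curve is a map C : R -> M that is
    only considered on the parameter interval I. *)

Definition smooth_curve {R : realType} {n : nat} (M : smooth_manifold R n)
    (I : set R) (C : R -> M) : Prop :=
  (forall t, I t -> {for t, continuous C}) /\
  (forall i, smooth_on (I `&` C @^-1` mdom i) (mchart i \o C)).

Definition velocity {R : realType} {n : nat} (M : smooth_manifold R n)
    (C : R -> M) (i : midx M) (t : R) : 'rV[R]_n :=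
  derive1 (mchart i \o C) t.

(* [V i t] is only relevant when C t is in the domain of the chart i. *)
Definition field_along {R : realType} {n : nat} (M : smooth_manifold R n)
    (I : set R) (C : R -> M) (V : midx M -> R -> 'rV[R]_n) : Prop :=
  (forall i, smooth_on (I `&` C @^-1` mdom i) (V i)) /\
  (forall i j t, I t -> mdom i (C t) -> mdom j (C t) ->
     V j t = V i t *m jac i j (C t)).

Definition cov_der {R : realType} {n : nat} (M : smooth_manifold R n)
    (G : connection M) (C : R -> M) (V : midx M -> R -> 'rV[R]_n)
    (i : midx M) (t : R) : 'rV[R]_n :=
  derive1 (V i) t + chr_eval (G i (C t)) (velocity C i t) (V i t).

Definition null_curve {R : realType} {n : nat} (M : smooth_manifold R n)
    (g : pseudo_metric M) (I : set R) (C : R -> M) : Prop :=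
  smooth_curve I C /\
  (forall t i, I t -> mdom i (C t) ->
     velocity C i t <> 0 /\
     form2 (g i (C t)) (velocity C i t) (velocity C i t) = 0).

Definition slant {R : realType} {M : smooth_manifold R 3} (S : acB_metric M)
    (I : set R) (C : R -> M) (a : R) : Prop :=
  forall t i, I t -> mdom i (C t) ->
    form1 (ac_eta S i (C t)) (velocity C i t) = a.

Definition general_frenet_frame {R : realType} {M : smooth_manifold R 3}
    (g : pseudo_metric M) (I : set R) (C : R -> M)
    (N W : midx M -> R -> 'rV[R]_3) : Prop :=
  [/\ field_along I C N, field_along I C W &
      forall t i, I t -> mdom i (C t) ->
        let c := velocity C i t in
        let gt := form2 (g i (C t)) in
        basis_of fullv [:: c; N i t; W i t] /\
        [/\ gt c (N i t) = 1, gt (W i t) (W i t) = 1,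
            gt (N i t) (N i t) = 0, gt (N i t) (W i t) = 0 &
            gt c (W i t) = 0]].

Definition frenet_functions {R : realType} {M : smooth_manifold R 3}
    (G : connection M) (I : set R) (C : R -> M)
    (N W : midx M -> R -> 'rV[R]_3) (h k1 k2 : R -> R) : Prop :=
  forall t i, I t -> mdom i (C t) ->
    [/\ cov_der G C (velocity C) i t =
          h t *: velocity C i t + k1 t *: W i t,
        cov_der G C N i t = - h t *: N i t + k2 t *: W i t &
        cov_der G C W i t = - k2 t *: velocity C i t - k1 t *: N i t].

Definition distinguished {R : realType} {M : smooth_manifold R 3}
    (G : connection M) (I : set R) (C : R -> M)
    (N W : midx M -> R -> 'rV[R]_3) : Prop :=
  exists h k1 k2, frenet_functions G I C N W h k1 k2 /\
    forall t, I t -> h t = 0.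

Definition non_geodesic {R : realType} {M : smooth_manifold R 3}
    (G : connection M) (I : set R) (C : R -> M)
    (N W : midx M -> R -> 'rV[R]_3) : Prop :=
  exists h k1 k2, frenet_functions G I C N W h k1 k2 /\
    forall t, I t -> k1 t <> 0.

Definition cartan_framed {R : realType} {M : smooth_manifold R 3}
    (g : pseudo_metric M) (G : connection M) (I : set R) (C : R -> M)
    (N W : midx M -> R -> 'rV[R]_3) (tau : R -> R) : Prop :=
  general_frenet_frame g I C N W /\
  forall t i, I t -> mdom i (C t) ->
    [/\ cov_der G C (velocity C) i t = W i t,
        cov_der G C N i t = tau t *: W i t &
        cov_der G C W i t = - tau t *: velocity C i t - N i t].

Definition frame_mx {R : realType} (x y z : 'rV[R]_3) : 'M[R]_3 :=
  \matrix_(k < 3) [:: x; y; z]`_k.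

(* {velocity C, N, W} has the same orientation as {velocity C, xi,
   phi (velocity C)}: the change-of-basis matrix has positive determinant. *)
Definition same_orientation {R : realType} {M : smooth_manifold R 3}
    (S : acB_metric M) (I : set R) (C : R -> M)
    (N W : midx M -> R -> 'rV[R]_3) : Prop :=
  forall t i, I t -> mdom i (C t) ->
    let c := velocity C i t in
    exists2 P : 'M[R]_3,
      frame_mx c (N i t) (W i t) =
      P *m frame_mx c (ac_xi S i (C t)) (c *m ac_phi S i (C t)) &
      0 < \det P.

Definition frame_W1 {R : realType} {M : smooth_manifold R 3}
    (S : acB_metric M) (C : R -> M) (a : R) (b : R -> R)
    (i : midx M) (t : R) : 'rV[R]_3 :=
  let alpha := - (b t / Num.sqrt (a ^+ 4 + b t ^+ 2)) in
  let gamma := a / Num.sqrt (a ^+ 4 + b t ^+ 2) in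
  alpha *: ac_xi S i (C t) - (alpha / a) *: velocity C i t
  + gamma *: (velocity C i t *m ac_phi S i (C t)).

Definition frame_N1 {R : realType} {M : smooth_manifold R 3}
    (S : acB_metric M) (C : R -> M) (a : R)
    (i : midx M) (t : R) : 'rV[R]_3 :=
  a^-1 *: ac_xi S i (C t) - (2 * a ^+ 2)^-1 *: velocity C i t.

Definition b_ode {R : realType} {M : smooth_manifold R 3}
    (S : acB_metric M) (theta : one_form M) (I : set R) (C : R -> M)
    (a : R) (b : R -> R) : Prop :=
  forall t i, I t -> mdom i (C t) ->
    is_derive t 1 b
      (b t * form1 (theta i (C t)) (velocity C i t *m ac_phi S i (C t))
       - a ^+ 2 * form1 (theta i (C t)) (velocity C i t)
       + 2 / a * Num.sqrt (a ^+ 4 + b t ^+ 2)).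

(* Main.v *)
Require Import Defs.
From HB Require Import structures.
From mathcomp Require Import all_boot all_order all_algebra.
From mathcomp Require Import all_classical all_reals all_analysis.
From mathcomp Require Import ring lra.
Import Order.TTheory GRing.Theory Num.Theory.
Import numFieldNormedType.Exports.
Local Open Scope classical_set_scope.
Local Open Scope ring_scope.

(** Work at one instant, in one chart, with c the velocity of the curve and D
    the covariant derivative along it.

    On an F1-manifold the formula for F gives F(c, xi, .) = 0, that is
    phi (D xi) = 0; as g(xi, xi) = 1 also makes D xi orthogonal to xi, the
    field xi is parallel along the curve ([cov_xi]).  Differentiating
    g(c, c) = 0 and g(c, xi) = a then shows that the acceleration D c is
    orthogonal to c and to xi, so that D c is known once g(D c, phi c) is.
    Differentiating b = g(c, phi c) with the formula for F(c, c, c) gives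
    b' = 2 g(D c, phi c) + b theta(phi c) - a^2 theta(c) ([is_derive_b]), where
    theta(xi) = 0 has been used.  So the differential equation for b says
    exactly that g(D c, phi c) = sqrt (a^4 + b^2) / a.  The vector W1 has the
    same products with c, xi and phi c, and these three vectors form a basis:
    their Gram determinant is - (a^4 + b^2).  Hence D c = W1
    ([acceleration]).

    The rest follows.  N1 is a combination of xi and c with constant
    coefficients and D xi = 0, whence D N1 = - (2 a^2)^-1 W1.  The
    derivative of W1 is found from the constant products of the frame.  For
    another frame with h = 0 one has W1 = k1 W, so W = W1 or W = - W1; in
    either case N = N1, and the orientation excludes the second one
    ([cartan_frame_unique]).

    On an F0-manifold theta vanishes along the curve and the equation becomes
    b' = (2 / a) sqrt (a^4 + b^2).  The function w = b + sqrt (a^4 + b^2) is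
    positive and satisfies w' = (2 / a) w, so it is exp (2 (t + u) / a), and
    b = (w - a^4 / w) / 2 ([sinh_ode_sol]).

    Smoothness of the frame fields needs a calculus of iterated
    differentiability: closure under sums, products, composition and
    q |-> 1 / sqrt q. *)

Set Implicit Arguments.
Unset Strict Implicit.
Unset Printing Implicit Defensive.

(** * Iterated differentiability *)

Section IteratedDifferentiability.
Variable R : realType.
Implicit Types (V W : normedModType R) (k : nat).

Lemma near_eq_diff V W (f g : V -> W) (x : V) :
  (\near x, f x = g x) -> differentiable f x ->
  differentiable g x /\ 'd g x = 'd f x :> (V -> W).
Proof.
move=> fg df; have [cf ef] := (diff_locallyP x f).1 df.
have e : g \o shift x = cst (g x) + 'd f x +o_ 0 id.
  apply/eqaddoP => _/posnumP[e].
  move/eqaddoP: ef => /(_ e%:num (gt0 e)) ef.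
  have fg0 : \forall h \near (0 : V), f (h + x) = g (h + x).
    by rewrite (near_shift x) sub0r; near do rewrite /= subrK.
  rewrite -(nbhs_singleton fg).
  near=> h; rewrite /= !fctE/= -(near fg0 h)//.
  by near: h.
have E : 'd g x = 'd f x :> (V -> W) by apply: diff_unique.
split; last exact: E.
by apply/diff_locallyP; rewrite E; split; [exact: cf|exact: e].
Unshelve. all: by end_near. Qed.

Lemma Ck_eq V W k (U : set V) (f g : V -> W) : open U ->
  (forall x, U x -> f x = g x) -> Ck k U f -> Ck k U g.
Proof.
move=> oU; elim: k f g => [|k IH] f g fg.
  move=> cf x Ux; rewrite /prop_for /continuous_at -(fg _ Ux).
  apply: cvg_trans (cf _ Ux); apply: near_eq_cvg.
  by apply: filterS (open_nbhs_nbhs (conj oU Ux)) => y /fg.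
have nfg x : U x -> \near x, f x = g x.
  by move=> Ux; apply: filterS (open_nbhs_nbhs (conj oU Ux)) => y /fg.
move=> [df cf]; split => [x Ux|v].
  exact: (near_eq_diff (nfg _ Ux) (df _ Ux)).1.
apply: IH (cf v) => x Ux.
by rewrite (near_eq_diff (nfg _ Ux) (df _ Ux)).2.
Qed.

Lemma CkS_Ck V W k (U : set V) (f : V -> W) : Ck k.+1 U f -> Ck k U f.
Proof.
elim: k f => [|k IH] f [df cf].
  by move=> x Ux; apply: differentiable_continuous; exact: df.
by split => // v; apply: IH; exact: cf.
Qed.

Lemma Ck_cst V W k (U : set V) (w : W) : Ck k U (fun=> w).
Proof.
elim: k w => [|k IH] w /=; first by move=> x _; exact: cst_continuous.
split => [x _|v]; first exact: differentiable_cst.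
have -> : (fun x => 'd (fun=> w) x v) = fun=> (0 : W).
  by apply/funext => x; rewrite (diff_cst w x).
exact: IH.
Qed.

Lemma CkD V W k (U : set V) (f g : V -> W) : open U ->
  Ck k U f -> Ck k U g -> Ck k U (fun x => f x + g x).
Proof.
move=> oU; elim: k f g => [|k IH] f g /=.
  by move=> cf cg x Ux; apply: cvgD; [exact: cf|exact: cg].
move=> [df cf] [dg cg]; split => [x Ux|v].
  by apply: differentiableD; [exact: df|exact: dg].
apply: Ck_eq (IH _ _ (cf v) (cg v)) => // x Ux.
have -> : (fun x => f x + g x) = f + g by [].
by rewrite diffD //; [exact: df|exact: dg].
Qed.

Lemma Ck_sum V W k (U : set V) (J : Type) (r : seq J) (f : J -> V -> W) :
  open U -> (forall j, Ck k U (f j)) -> Ck k U (fun x => \sum_(j <- r) f j x).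
Proof.
move=> oU cf; elim: r => [|j r IH].
  by under eq_fun do rewrite big_nil; exact: Ck_cst.
by under eq_fun do rewrite big_cons; exact: CkD.
Qed.

Lemma CkZl V W k (U : set V) (f : V -> R) (w : W) : open U ->
  Ck k U f -> Ck k U (fun x => f x *: w).
Proof.
move=> oU; elim: k f => [|k IH] f /=.
  by move=> cf x Ux; apply: cvgZr_tmp; exact: cf.
move=> [df cf]; split => [x Ux|v].
  by apply: differentiableZl; exact: df.
apply: Ck_eq (IH _ (cf v)) => // x Ux.
by rewrite diffZl //; exact: df.
Qed.

Lemma CkM V k (U : set V) (f g : V -> R) : open U ->
  Ck k U f -> Ck k U g -> Ck k U (fun x => f x * g x).
Proof.
move=> oU; elim: k f g => [|k IH] f g.
  by move=> cf cg x Ux; apply: cvgM; [exact: cf|exact: cg].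
move=> Cf Cg; have [df cf] := Cf; have [dg cg] := Cg; split => [x Ux|v].
  by apply: differentiableM; [exact: df|exact: dg].
have : Ck k U (fun x => f x * 'd g x v + g x * 'd f x v).
  exact: (CkD oU (IH _ _ (CkS_Ck Cf) (cg v)) (IH _ _ (CkS_Ck Cg) (cf v))).
apply: Ck_eq => // x Ux.
have -> : (fun x => f x * g x) = f * g by [].
by rewrite diffM //; [exact: df|exact: dg].
Qed.

Lemma Ck_coord V k (U : set V) m n (F : V -> 'M[R]_(m, n)) i j : open U ->
  Ck k U F -> Ck k U (fun x => F x i j).
Proof.
move=> oU; elim: k F => [|k IH] F /=.
  move=> cF x Ux; apply: (@cvg_comp _ _ _ F (fun N : 'M[R]_(m, n) => N i j)).
    exact: cF.
  exact: coord_continuous.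
move=> [dF cF]; split => [x Ux|v].
  apply: (@differentiable_comp _ _ _ _ F (fun N : 'M[R]_(m, n) => N i j)).
    exact: dF.
  exact: differentiable_coord.
apply: Ck_eq (IH _ (cF v)) => // x Ux.
have dFv := diff_derivable (v := v) (dF _ Ux).
rewrite -(deriveE v (dF _ Ux)) derive_mx // mxE deriveE //.
apply: (@differentiable_comp _ _ _ _ F (fun N : 'M[R]_(m, n) => N i j)).
  exact: dF.
exact: differentiable_coord.
Qed.

(** Matrix-valued maps are handled through their entries, so products and
    compositions only have to be treated for scalar functions. *)
Lemma Ck_mx V k (U : set V) m n (F : V -> 'M[R]_(m, n)) : open U ->
  (forall i j, Ck k U (fun x => F x i j)) -> Ck k U F.
Proof.
move=> oU cF.
have -> : F = fun x => \sum_i \sum_j F x i j *: delta_mx i j.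
  by apply/funext => x; rewrite -matrix_sum_delta.
apply: Ck_sum => // i; apply: Ck_sum => // j; exact: CkZl.
Qed.

Lemma linear_rV_delta n (L : {linear 'rV[R]_n -> R}) (u : 'rV[R]_n) :
  L u = \sum_i u 0 i * L (delta_mx 0 i).
Proof.
rewrite [in LHS](row_sum_delta u) linear_sum.
by apply: eq_bigr => i _; rewrite linearZ.
Qed.

(** The derivative of the composite is a sum of products of entries of 'd g with
    the composite of a partial derivative of f: the induction hypothesis
    applies because the direction of differentiation of f is then constant. *)
Lemma Ck_comp V k n (U : set V) (O : set 'rV[R]_n) (g : V -> 'rV[R]_n)
    (f : 'rV[R]_n -> R) : open U -> (forall x, U x -> O (g x)) ->
  Ck k U g -> Ck k O f -> Ck k U (f \o g).
Proof.
move=> oU UO; elim: k f => [|k IH] f.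
  by move=> cg cf x Ux; apply: continuous_comp; [exact: cg|exact/cf/UO].
move=> Cg; have [dg cg] := Cg; move=> [df cf].
have Dg x : U x -> differentiable g x by exact: dg.
have Df x : U x -> differentiable f (g x) by move=> Ux; exact/df/UO.
split => [x Ux|v]; first by apply: differentiable_comp; [exact: Dg|exact: Df].
have : Ck k U (fun x => \sum_i 'd g x v 0 i * ('d f (g x) (delta_mx 0 i))).
  apply: Ck_sum => // i; apply: CkM => //; first exact: Ck_coord (cg v).
  exact: (IH (fun y => 'd f y (delta_mx 0 i)) (CkS_Ck Cg) (cf _)).
apply: Ck_eq => // x Ux; rewrite (diff_comp (Dg _ Ux) (Df _ Ux)) /=.
by rewrite (linear_rV_delta ('d f (g x))).
Qed.

Lemma CkN V k (U : set V) (f : V -> R) : open U ->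
  Ck k U f -> Ck k U (fun x => - f x).
Proof.
move=> oU cf; under eq_fun do rewrite -mulN1r.
by apply: CkM => //; exact: Ck_cst.
Qed.

Definition rsqrt (x : R) : R := (Num.sqrt x)^-1.

(** The derivative of 1 / sqrt is a polynomial in 1 / sqrt itself, so that
    [Ck_rsqrt] below is a plain induction on the order, and neither the square
    root nor the inverse has to be treated alone. *)
Lemma is_derive_rsqrt (x : R) : 0 < x ->
  is_derive x 1 rsqrt (- 2^-1 * rsqrt x ^+ 3).
Proof.
move=> x0; have ds := is_derive1_sqrt x0.
have s0 : Num.sqrt x != 0 by rewrite sqrtr_eq0 -ltNge.
apply: (is_derive_eq (is_deriveV s0 ds)).
by rewrite /rsqrt /GRing.scale /=; field.
Qed.

Lemma diff_rsqrt (V : normedModType R) (q : V -> R) x :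
  differentiable q x -> 0 < q x ->
  differentiable (rsqrt \o q) x /\
  forall v, 'd (rsqrt \o q) x v = - 2^-1 * rsqrt (q x) ^+ 3 * 'd q x v.
Proof.
move=> dq q0; have [dr er] := is_derive_rsqrt q0.
have Dr : differentiable rsqrt (q x) by exact/derivable1_diffP.
split => [|v]; first exact: differentiable_comp.
rewrite (diff_comp dq Dr) /= (diff1E Dr) derive1E er.
by rewrite /GRing.scale /= mulrC.
Qed.

Lemma Ck_rsqrt V k (U : set V) (q : V -> R) : open U ->
  (forall x, U x -> 0 < q x) -> Ck k U q -> Ck k U (rsqrt \o q).
Proof.
move=> oU q0; elim: k => [|k IH].
  move=> cq x Ux; apply: (@continuous_comp _ _ _ q rsqrt); first exact: cq.
  apply: differentiable_continuous; apply/derivable1_diffP.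
  by have [] := is_derive_rsqrt (q0 _ Ux).
move=> Cq; have [dq cq] := Cq; split => [x Ux|v].
  by have [] := diff_rsqrt (dq _ Ux) (q0 _ Ux).
have cr := IH (CkS_Ck Cq).
have : Ck k U (fun x => - 2^-1 * rsqrt (q x) ^+ 3 * 'd q x v).
  apply: (CkM oU _ (cq v)); apply: CkM => //; first exact: Ck_cst.
  by under eq_fun do rewrite 2!exprS expr1; do 2 apply: CkM => //.
apply: Ck_eq => // x Ux.
by have [_ ->] := diff_rsqrt (dq _ Ux) (q0 _ Ux).
Qed.

Lemma Ck_derive1 W k (U : set R) (f : R -> W) : open U ->
  Ck k.+1 U f -> Ck k U (derive1 f).
Proof.
move=> oU [df cf]; apply: Ck_eq (cf 1) => // x Ux.
by rewrite derive1E'//; exact: df.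
Qed.

Lemma Ck_mulmx V k (U : set V) m n p (F : V -> 'M[R]_(m, n))
    (H : V -> 'M[R]_(n, p)) : open U ->
  Ck k U F -> Ck k U H -> Ck k U (fun x => F x *m H x).
Proof.
move=> oU cF cH; apply: Ck_mx => // i j; under eq_fun do rewrite mxE.
by apply: Ck_sum => // l; apply: CkM => //; exact: Ck_coord.
Qed.

Lemma Ck_scale_mx V k (U : set V) m n (f : V -> R) (F : V -> 'M[R]_(m, n)) :
  open U -> Ck k U f -> Ck k U F -> Ck k U (fun x => f x *: F x).
Proof.
move=> oU cf cF; apply: Ck_mx => // i j; under eq_fun do rewrite mxE.
by apply: CkM => //; exact: Ck_coord.
Qed.

Lemma Ck_comp_mx V k l m n (U : set V) (O : set 'rV[R]_n) (g : V -> 'rV[R]_n)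
    (F : 'rV[R]_n -> 'M[R]_(l, m)) : open U -> open O ->
  (forall x, U x -> O (g x)) -> Ck k U g -> Ck k O F -> Ck k U (F \o g).
Proof.
move=> oU oO UO cg cF; apply: Ck_mx => // i j.
by apply: (Ck_comp (f := fun y => F y i j) oU UO cg); exact: Ck_coord.
Qed.

Lemma Ck_trmx V k (U : set V) m n (F : V -> 'M[R]_(m, n)) : open U ->
  Ck k U F -> Ck k U (fun x => (F x)^T).
Proof.
move=> oU cF; apply: Ck_mx => // i j; under eq_fun do rewrite mxE.
exact: Ck_coord.
Qed.

Lemma Ck_form2 V k n (U : set V) (g : V -> 'M[R]_n) (X Y : V -> 'rV[R]_n) :
  open U -> Ck k U g -> Ck k U X -> Ck k U Y ->
  Ck k U (fun x => form2 (g x) (X x) (Y x)).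
Proof.
move=> oU cg cX cY; apply: Ck_coord => //.
by apply: Ck_mulmx => //; [exact: Ck_mulmx|exact: Ck_trmx].
Qed.

End IteratedDifferentiability.

(** * Bilinear forms and frames of a three-dimensional space *)

Section BilinearForms.
Variables (R : realType) (n : nat).
Implicit Types (g : 'M[R]_n) (w : 'cV[R]_n) (x y z : 'rV[R]_n).

Lemma form1D w x y : form1 w (x + y) = form1 w x + form1 w y.
Proof. by rewrite /form1 mulmxDl mxE. Qed.

Lemma form1Z w k x : form1 w (k *: x) = k * form1 w x.
Proof. by rewrite /form1 -scalemxAl mxE. Qed.

Lemma form1N w x : form1 w (- x) = - form1 w x.
Proof. by rewrite -scaleN1r form1Z mulN1r. Qed.

Lemma form10 w : form1 w 0 = 0.
Proof. by rewrite /form1 mul0mx mxE. Qed.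

Lemma form2Dl g x y z : form2 g (x + y) z = form2 g x z + form2 g y z.
Proof. by rewrite /form2 !mulmxDl mxE. Qed.

Lemma form2Zl g k x z : form2 g (k *: x) z = k * form2 g x z.
Proof. by rewrite /form2 -!scalemxAl mxE. Qed.

Lemma form2Nl g x z : form2 g (- x) z = - form2 g x z.
Proof. by rewrite -scaleN1r form2Zl mulN1r. Qed.

Lemma form20l g z : form2 g 0 z = 0.
Proof. by rewrite /form2 !mul0mx mxE. Qed.

Lemma form2Dr g x y z : form2 g z (x + y) = form2 g z x + form2 g z y.
Proof. by rewrite /form2 linearD mulmxDr mxE. Qed.

Lemma form2Zr g k x z : form2 g z (k *: x) = k * form2 g z x.
Proof. by rewrite /form2 linearZ -scalemxAr mxE. Qed.

Lemma form2Nr g x z : form2 g z (- x) = - form2 g z x.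
Proof. by rewrite -scaleN1r form2Zr mulN1r. Qed.

Lemma form20r g z : form2 g z 0 = 0.
Proof. by rewrite /form2 trmx0 mulmx0 mxE. Qed.

Lemma form2C g x y : g^T = g -> form2 g x y = form2 g y x.
Proof.
move=> gT; rewrite /form2 -[in RHS](trmxK (y *m g *m x^T)) [in RHS]mxE.
by rewrite !trmx_mul trmxK gT mulmxA.
Qed.

Definition form2_lin :=
  (form2Dl, form2Zl, form2Nl, form20l, form2Dr, form2Zr, form2Nr, form20r).

Lemma form2_eq0 g x : g \in unitmx -> (forall z, form2 g x z = 0) -> x = 0.
Proof.
move=> gU gx; rewrite -[x](mulmxK gU) -[RHS](mul0mx _ (invmx g)).
congr (_ *m _).
apply/rowP => j; have := gx (delta_mx 0 j).
by rewrite /form2 trmx_delta -colE !mxE.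
Qed.

Lemma chr_evalDr (G : 'I_n -> 'I_n -> 'rV[R]_n) x y z :
  chr_eval G x (y + z) = chr_eval G x y + chr_eval G x z.
Proof.
rewrite /chr_eval -big_split; apply: eq_bigr => k _ /=.
rewrite -big_split; apply: eq_bigr => l _ /=.
by rewrite mxE mulrDr scalerDl.
Qed.

Lemma chr_evalZr (G : 'I_n -> 'I_n -> 'rV[R]_n) x k y :
  chr_eval G x (k *: y) = k *: chr_eval G x y.
Proof.
rewrite /chr_eval scaler_sumr; apply: eq_bigr => i _ /=.
rewrite scaler_sumr; apply: eq_bigr => l _ /=.
by rewrite mxE scalerA mulrCA.
Qed.

End BilinearForms.

Section Frames.
Variable R : realType.
Implicit Types (g : 'M[R]_3) (x y z v : 'rV[R]_3).

Lemma mul_frame_mx v x y z :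
  v *m frame_mx x y z = v 0 0 *: x + v 0 1 *: y + v 0 (inord 2) *: z.
Proof.
rewrite mulmx_sum_row !big_ord_recl big_ord0 addr0 !rowK /= addrA.
congr (_ + _ *: _ + _ *: _); congr (v _ _); first exact/val_inj.
by apply/val_inj; rewrite /= inordK.
Qed.

(** Linear independence of three vectors as invertibility of the matrix of their
    components: coordinates and orientation are then matrix algebra. *)
Lemma frame_mx_unit x y z :
  (forall k l m : R,
     k *: x + l *: y + m *: z = 0 -> [/\ k = 0, l = 0 & m = 0]) ->
  frame_mx x y z \in unitmx.
Proof.
move=> H; rewrite -row_free_unit; apply: inj_row_free => v.
rewrite mul_frame_mx => /H[v0 v1 v2]; apply/rowP => j; rewrite mxE.
case: j => -[|[|[|//]]] lt_j; [rewrite -{}v0|rewrite -{}v1|rewrite -{}v2];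
  by congr (v _ _); apply/val_inj; rewrite /= ?inordK.
Qed.

Lemma frame_mx_unitP x y z (k l m : R) : frame_mx x y z \in unitmx ->
  k *: x + l *: y + m *: z = 0 -> [/\ k = 0, l = 0 & m = 0].
Proof.
move=> U; pose v : 'rV[R]_3 := \row_j [:: k; l; m]`_j.
have -> : k *: x + l *: y + m *: z = v *m frame_mx x y z.
  by rewrite mul_frame_mx !mxE inordK.
move=> v0; have {}v0 : v = 0 by rewrite -[v](mulmxK U) v0 mul0mx.
split; [move: v0 => /rowP/(_ 0)|move: v0 => /rowP/(_ 1)|
  move: v0 => /rowP/(_ (inord 2))]; by rewrite !mxE /= ?inordK.
Qed.

Lemma frame_mx_basis x y z :
  basis_of fullv [:: x; y; z] = (frame_mx x y z \in unitmx).
Proof.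
have E (k : 'I_3 -> R) : \sum_(i < 3) k i *: [:: x; y; z]`_i =
    (\row_i k i) *m frame_mx x y z.
  by rewrite mulmx_sum_row; apply: eq_bigr => i _; rewrite rowK mxE.
apply/idP/idP => [/basis_free/(@freeP _ _ 3 [tuple x; y; z]) H|U].
  apply: frame_mx_unit => k l m klm.
  have := H (fun i : 'I_3 => [:: k; l; m]`_i).
  rewrite 3!big_ord_recl big_ord0 addr0 addrA /= => /(_ klm) H0.
  split; [exact: (H0 0)|exact: (H0 1)|].
  exact: (H0 (Ordinal (isT : (2 < 3)%N))).
rewrite basisEfree subvf dimvf /= andbT.
apply/(@freeP _ _ 3 [tuple x; y; z]) => k.
rewrite E => /(canRL (mulmxK U)); rewrite mul0mx => /rowP H i.
by have := H i; rewrite !mxE.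
Qed.

(** Only the products of a covariant derivative with the vectors of a frame are
    ever computed; this is what then identifies it. *)
Lemma frame_mx_ext g x y z v v' : g \in unitmx -> frame_mx x y z \in unitmx ->
  form2 g v x = form2 g v' x -> form2 g v y = form2 g v' y ->
  form2 g v z = form2 g v' z -> v = v'.
Proof.
move=> gU U ex ey ez; apply/subr0_eq/(form2_eq0 gU) => w.
rewrite -(mulmxKV U w) mul_frame_mx !form2_lin ex ey ez.
ring.
Qed.

End Frames.

(** * The equation b' = (2 / a) sqrt (a^4 + b^2) *)

(** The mean value theorem on the segment between the two points, which lies in
    the interval. *)
Lemma is_derive0_constant_on (R : realType) (I : set R) (f : R -> R) :
  is_interval I ->
  (forall t, I t -> is_derive t 1 f 0) ->
  forall x y, I x -> I y -> f x = f y.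
Proof.
move=> itvI df.
suff H x y : I x -> I y -> x < y -> f x = f y.
  move=> x y Ix Iy; have [xy|yx|->//] := ltgtP x y; first exact: H.
  by apply/esym; exact: H.
move=> Ix Iy xy.
have Iz z : z \in `[x, y] -> I z.
  by rewrite in_itv /=; exact: itvI.
have [||z _] := @MVT R f (fun=> 0) x y xy.
- by move=> z zxy; apply/df/Iz/subset_itv_oo_cc.
- apply: derivable_within_continuous => z zxy.
  by have [] := df _ (Iz _ zxy).
- by rewrite mul0r => /subr0_eq ->.
Qed.

Lemma a4b2_gt0 (R : realType) (a r : R) : a != 0 -> 0 < a ^+ 4 + r ^+ 2.
Proof.
by move=> a0; rewrite ltr_wpDr ?sqr_ge0 // lt0r expf_neq0 //= exprn_even_ge0.
Qed.

Section SeparableEquation.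
Variables (R : realType) (a : R).
Hypothesis a0 : a != 0.

Let pos (r : R) : 0 < a ^+ 4 + r ^+ 2. Proof. exact: a4b2_gt0. Qed.

Let sq (r : R) : R := Num.sqrt (a ^+ 4 + r ^+ 2).
Let sq0 r : 0 < sq r. Proof. by rewrite sqrtr_gt0 pos. Qed.
Let sq2 r : sq r ^+ 2 = a ^+ 4 + r ^+ 2.
Proof. by rewrite sqr_sqrtr // ltW. Qed.

Let wpos r : 0 < r + sq r.
Proof.
rewrite -ltrBlDl sub0r (le_lt_trans (ler_norm _)) // normrN -sqrtr_sqr.
by rewrite ltr_sqrt ?pos // ltrDr lt0r expf_neq0 //= exprn_even_ge0.
Qed.

(** From left to right, w = b + sqrt (a^4 + b^2) satisfies w' = (2 / a) w, so
    that w exp (- 2 t / a) is constant; from right to left, sqrt (a^4 + b^2) is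
    (w + a^4 / w) / 2. *)
Lemma sinh_ode_sol (I : set R) (b : R -> R) : open I -> is_interval I ->
  (forall t, I t -> is_derive t 1 b (2 / a * Num.sqrt (a ^+ 4 + b t ^+ 2))) <->
  exists u : R, forall t, I t ->
    b t = 2^-1 * (expR (2 * (t + u) / a)
                  - a ^+ 4 * expR (- (2 * (t + u) / a))).
Proof.
move=> oI itvI; split=> [db|[u bE] t It].
  pose f t := (b t + sq (b t)) * expR (- (2 / a) * t).
  have df t : I t -> is_derive t 1 f 0.
    move=> It; have dbt := db _ It.
    have dq : is_derive t 1 (fun s => a ^+ 4 + b s ^+ 2)
        (2 * b t * (2 / a * sq (b t))).
      apply: is_derive_eq; rewrite /GRing.scale /= /sq; ring.
    have ds : is_derive t 1 (fun s => sq (b s)) (2 / a * b t).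
      have D := @is_derive1_comp _ Num.sqrt (fun s => a ^+ 4 + b s ^+ 2) _ _ _
        (is_derive1_sqrt (pos (b t))) dq.
      apply: (is_derive_eq D); rewrite -/(sq (b t)).
      by field; rewrite a0 gt_eqF.
    have de : is_derive t 1 (fun s => expR (- (2 / a) * s))
       (- (2 / a) * expR (- (2 / a) * t)).
      apply: is_derive_eq; rewrite /GRing.scale /=; ring.
    apply: is_derive_eq; rewrite /GRing.scale /= -/(sq (b t)); ring.
  have [[t0 It0]|nI] := pselect (exists t, I t); last first.
    by exists 0 => t It; case: nI; exists t.
  have ft0 : 0 < f t0 by rewrite mulr_gt0 // expR_gt0.
  (* The constant value of w exp (- 2 t / a) is exp (2 u / a). *)
  exists (a / 2 * ln (f t0)) => t It.
  have : f t = f t0 by exact: (is_derive0_constant_on itvI df).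
  have -> : 2 * (t + a / 2 * ln (f t0)) / a = 2 / a * t + ln (f t0).
    by field.
  rewrite opprD !expRD !expRN lnK; last by rewrite posrE.
  set e := expR (2 / a * t); set K := f t0 => fE.
  have e0 : e != 0 by rewrite gt_eqF // expR_gt0.
  have w0 : b t + sq (b t) != 0 by rewrite gt_eqF.
  have wE : e * K = b t + sq (b t).
    by rewrite -fE /f mulNr expRN -/e; field.
  rewrite -invfM wE; apply: (canRL (mulKf _)); first by rewrite pnatr_eq0.
  rewrite (_ : a ^+ 4 = sq (b t) ^+ 2 - b t ^+ 2); last by rewrite sq2; ring.
  by field.
set e := fun s : R => expR (2 * (s + u) / a).
have e0 s : 0 < e s by exact: expR_gt0.
have ne s : e s != 0 by rewrite gt_eqF.
have bE' s : I s -> b s = 2^-1 * (e s - a ^+ 4 * (e s)^-1).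
  by move=> Is; rewrite bE // expRN.
have nb : \near t, 2^-1 * (e t - a ^+ 4 * (e t)^-1) = b t.
  by apply: filterS (open_nbhs_nbhs (conj oI It)) => s /bE' ->.
apply: near_eq_is_derive nb _.
have de : is_derive t 1 e (2 / a * e t).
  by apply: is_derive_eq; rewrite /GRing.scale /= /e; ring.
have dve : is_derive t 1 (fun s => (e s)^-1) (- (2 / a) * (e t)^-1).
  apply: (is_derive_eq (is_deriveV (ne t) de)).
  by rewrite /GRing.scale /=; field; rewrite a0 ne.
apply: is_derive_eq.
have -> : Num.sqrt (a ^+ 4 + b t ^+ 2) = 2^-1 * (e t + a ^+ 4 * (e t)^-1).
  apply: (@pexpIrn _ 2); rewrite ?nnegrE ?sqrtr_ge0 //.
    apply: mulr_ge0; first by rewrite invr_ge0.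
    apply: addr_ge0; first exact: ltW.
    by apply: divr_ge0; [exact: exprn_even_ge0|exact: ltW].
  by rewrite sq2 bE' //; field.
by rewrite /GRing.scale /=; field; rewrite a0 ne.
Qed.
End SeparableEquation.

(** * An almost contact B-metric tangent space *)

(** An almost contact B-metric structure on a single tangent space.  With it the
    frame computations are linear algebra, free of points and charts. *)
Record acB_tangent (R : realType) (g phi : 'M[R]_3) (eta : 'cV[R]_3)
    (xi : 'rV[R]_3) : Prop := AcBTangent {
  tphi2 : forall x, x *m phi *m phi = - x + form1 eta x *: xi;
  teta_xi : form1 eta xi = 1;
  tgphi : forall x y,
    form2 g (x *m phi) (y *m phi) = - form2 g x y + form1 eta x * form1 eta y;
  tsym : g^T = g;
  tnondeg : g \in unitmx }.

(** The velocity of a slant null curve at one instant. *)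
Record slant_null_vector (R : realType) (g phi : 'M[R]_3) (eta : 'cV[R]_3)
    (c : 'rV[R]_3) (a b : R) : Prop := SlantNullVector {
  tnull : form2 g c c = 0;
  tslant : form1 eta c = a;
  tslant_neq0 : a != 0;
  tb : form2 g c (c *m phi) = b }.

(** Here pc stands for phi c; with c the velocity, this is [frame_W1] at one
    instant, up to conversion. *)
Definition cartan_W (R : realType) (xi c pc : 'rV[R]_3) (a b : R) :=
  let alpha := - (b / Num.sqrt (a ^+ 4 + b ^+ 2)) in
  let gamma := a / Num.sqrt (a ^+ 4 + b ^+ 2) in
  alpha *: xi - (alpha / a) *: c + gamma *: pc.

Definition cartan_N (R : realType) (xi c : 'rV[R]_3) (a : R) :=
  a^-1 *: xi - (2 * a ^+ 2)^-1 *: c.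

Section TangentSpace.
Variables (R : realType) (g phi : 'M[R]_3) (eta : 'cV[R]_3) (xi : 'rV[R]_3).
Hypothesis H : acB_tangent g phi eta xi.
Let phi2 := tphi2 H.
Let eta_xi := teta_xi H.
Let gphi := tgphi H.
Let gT := tsym H.
Let gU := tnondeg H.

(** As phi^2 xi = 0, applying phi^2 = - id + eta (x) xi to phi xi shows that
    phi xi is a multiple of xi, whose coefficient has square zero. *)
Lemma phi_xi : xi *m phi = 0.
Proof.
have p2 : xi *m phi *m phi = 0 by rewrite phi2 eta_xi scale1r addNr.
have := phi2 (xi *m phi); rewrite p2 mul0mx.
set k := form1 _ _ => /esym/eqP; rewrite addrC subr_eq0 => /eqP p1.
move: p2; rewrite -p1 -scalemxAl -p1 scalerA => /(congr1 (form1 eta)).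
rewrite form1Z eta_xi form10 mulr1 => /eqP; rewrite mulf_eq0 orbb => /eqP ->.
by rewrite scale0r.
Qed.

(** phi^3 is both phi o phi^2 and phi^2 o phi. *)
Lemma eta_phi x : form1 eta (x *m phi) = 0.
Proof.
have := phi2 (x *m phi); rewrite [x *m phi *m phi]phi2.
rewrite mulmxDl mulNmx -scalemxAl phi_xi scaler0 => /addrI/esym.
move=> /(congr1 (form1 eta)).
by rewrite form1Z eta_xi form10 mulr1.
Qed.

Lemma g_xi x : form2 g x xi = form1 eta x.
Proof.
have := gphi x xi; rewrite phi_xi form20r eta_xi mulr1 addrC => /esym/eqP.
by rewrite subr_eq0 => /eqP.
Qed.

Lemma phi_selfadj x y : form2 g (x *m phi) y = form2 g x (y *m phi).
Proof.
have := gphi x (y *m phi).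
rewrite phi2 eta_phi mulr0 addr0 !form2_lin g_xi eta_phi mulr0 addr0.
exact: oppr_inj.
Qed.

Variables (c : 'rV[R]_3) (a b : R).
Hypothesis Hc : slant_null_vector g phi eta c a b.
Let cc := tnull Hc.
Let c_xi := tslant Hc.
Let a0 := tslant_neq0 Hc.
Let s := Num.sqrt (a ^+ 4 + b ^+ 2).

Let gC x y : form2 g x y = form2 g y x. Proof. exact: form2C. Qed.

Let gcxi : form2 g c xi = a. Proof. by rewrite g_xi c_xi. Qed.
Let gxic : form2 g xi c = a. Proof. by rewrite gC. Qed.
Let gxixi : form2 g xi xi = 1. Proof. by rewrite g_xi. Qed.
Let gcp := tb Hc.
Let gpc : form2 g (c *m phi) c = b. Proof. by rewrite gC. Qed.
Let gpxi : form2 g (c *m phi) xi = 0. Proof. by rewrite g_xi eta_phi. Qed.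
Let gxip : form2 g xi (c *m phi) = 0. Proof. by rewrite gC. Qed.
Let gpp : form2 g (c *m phi) (c *m phi) = a ^+ 2.
Proof. by rewrite gphi cc c_xi oppr0 add0r expr2. Qed.
Let gE := (cc, gcxi, gxic, gxixi, gcp, gpc, gpxi, gxip, gpp).

(** The Gram matrix of (c, xi, phi c) has rows (0, a, b), (a, 1, 0) and
    (b, 0, a^2); its determinant - (a^4 + b^2) is nonzero. *)
Lemma phi_frame_unit : frame_mx c xi (c *m phi) \in unitmx.
Proof.
apply: frame_mx_unit => k l m klm.
have pair x : form2 g (k *: c + l *: xi + m *: (c *m phi)) x = 0.
  by rewrite klm form20l.
have := pair c; have := pair xi; have := pair (c *m phi).
rewrite !form2_lin !gE => e1 e2 e3.
have k0 : k = 0.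
  (* b e1 + a^3 e2 - a^2 e3 eliminates l and m. *)
  have : k * (a ^+ 4 + b ^+ 2) = 0.
    move: (congr1 ( *%R b) e1) (congr1 ( *%R (a ^+ 3)) e2).
    by move: (congr1 ( *%R (a ^+ 2)) e3); lra.
  by move/eqP; rewrite mulf_eq0 (gt_eqF (a4b2_gt0 b a0)) orbF => /eqP.
have l0 : l = 0 by move: e2; rewrite k0; lra.
have : m * a ^+ 2 = 0 by move: e1; rewrite k0; lra.
by move/eqP; rewrite mulf_eq0 expf_eq0 (negPf a0) /= orbF => /eqP.
Qed.

(** A basis of the shape that the definition of the Lee form requires, with the
    first two vectors in the kernel of eta. *)
Lemma ker_eta_frame_unit : frame_mx (c - a *: xi) (c *m phi) xi \in unitmx.
Proof.
apply: frame_mx_unit => k l m klm.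
have : k *: c + (m - k * a) *: xi + l *: (c *m phi) = 0.
  by rewrite -klm; move: (c *m phi) => p; apply/rowP => j; rewrite !mxE; ring.
move=> /(frame_mx_unitP phi_frame_unit)[-> /eqP + ->].
by rewrite mul0r subr0 => /eqP ->.
Qed.

Lemma eta_sub_xi : form1 eta (c - a *: xi) = 0.
Proof. by rewrite form1D form1N form1Z c_xi eta_xi mulr1 subrr. Qed.

Let alpha := - (b / s).
Let gamma := a / s.
Let W1 := cartan_W xi c (c *m phi) a b.
Let N1 := cartan_N xi c a.
Let W1E : W1 = alpha *: xi - (alpha / a) *: c + gamma *: (c *m phi).
Proof. by []. Qed.

Let s0 : s != 0. Proof. by rewrite gt_eqF // sqrtr_gt0 a4b2_gt0. Qed.
Let s2 : s ^+ 2 = a ^+ 4 + b ^+ 2.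
Proof. by rewrite sqr_sqrtr // ltW // a4b2_gt0. Qed.

Lemma cartan_W_c : form2 g W1 c = 0.
Proof. by rewrite W1E !form2_lin !gE /alpha /gamma; field; rewrite a0 s0. Qed.

Lemma cartan_W_xi : form2 g W1 xi = 0.
Proof. by rewrite W1E !form2_lin !gE /alpha /gamma; field; rewrite a0 s0. Qed.

(** With this value, W1 is the vector orthogonal to c and xi that the
    differential equation for b prescribes as acceleration. *)
Lemma cartan_W_phi : form2 g W1 (c *m phi) = s / a.
Proof.
rewrite W1E !form2_lin !gE /alpha /gamma.
have -> : s / a = s ^+ 2 / (a * s) by field; rewrite a0 s0.
by rewrite s2; field; rewrite a0 s0.
Qed.

Lemma cartan_N_c : form2 g N1 c = 1.
Proof. by rewrite /N1 /cartan_N !form2_lin !gE; field; rewrite a0. Qed.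

Lemma cartan_N_null : form2 g N1 N1 = 0.
Proof. by rewrite /N1 /cartan_N !form2_lin !gE; field; rewrite a0. Qed.

Lemma cartan_W_N : form2 g W1 N1 = 0.
Proof.
rewrite /N1 /cartan_N !form2Dr !form2Nr !form2Zr cartan_W_c cartan_W_xi.
by rewrite !mulr0 oppr0 addr0.
Qed.

Lemma cartan_W_unit : form2 g W1 W1 = 1.
Proof.
rewrite {2}W1E !form2Dr !form2Nr !form2Zr cartan_W_c cartan_W_xi cartan_W_phi.
by rewrite /gamma; field; rewrite a0 s0.
Qed.

Lemma cartan_frameE : exists2 P : 'M[R]_3,
  frame_mx c N1 W1 = P *m frame_mx c xi (c *m phi) & \det P = s^-1.
Proof.
exists (frame_mx (\row_j [:: 1; 0; 0]`_j)
          (\row_j [:: - (2 * a ^+ 2)^-1; a^-1; 0]`_j)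
          (\row_j [:: - (alpha / a); alpha; gamma]`_j)).
  apply/row_matrixP => i; rewrite row_mul !rowK.
  case: i => -[|[|[|//]]] lt_i; rewrite /= mul_frame_mx !mxE /= inordK //=.
  - by rewrite scale1r !scale0r !addr0.
  - by rewrite scale0r addr0 scaleNr addrC.
  - by rewrite scaleNr [- _ + _]addrC.
rewrite det_trig; last first.
  apply/is_trig_mxP => i j; rewrite mxE.
  by case: i => -[|[|[|//]]] i3; case: j => -[|[|[|//]]] j3; rewrite //= mxE.
rewrite !big_ord_recl big_ord0 !mxE /gamma /=.
by field; rewrite a0 s0.
Qed.

Lemma cartan_frame_orientation : exists2 Q : 'M[R]_3,
  frame_mx c N1 W1 = Q *m frame_mx c xi (c *m phi) & 0 < \det Q.
Proof.
have [P EP dP] := cartan_frameE; exists P => //.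
by rewrite dP invr_gt0 sqrtr_gt0 a4b2_gt0.
Qed.

Lemma cartan_frame_unit : frame_mx c N1 W1 \in unitmx.
Proof.
have [P -> dP] := cartan_frameE; rewrite unitmx_mul phi_frame_unit andbT.
by rewrite unitmxE dP unitfE invr_eq0.
Qed.

(** The null line of the plane orthogonal to W1 other than that of c contains
    only one vector whose product with c is 1; so N = N1 whatever the sign of
    W, and W = - W1 would reverse the orientation. *)
Lemma cartan_frame_unique N W : W = W1 \/ W = - W1 ->
  form2 g c N = 1 -> form2 g N N = 0 -> form2 g N W = 0 ->
  (exists2 Q : 'M[R]_3,
     frame_mx c N W = Q *m frame_mx c xi (c *m phi) & 0 < \det Q) ->
  N = N1 /\ W = W1.
Proof.
move=> WW cN NN NW [Q EQ Q0].
have gNW1 : form2 g N W1 = 0.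
  by case: WW NW => -> //; rewrite form2Nr => /eqP; rewrite oppr_eq0 => /eqP.
have NE : N = N1.
  (* N - N1 is orthogonal to c and W1, hence a multiple of c. *)
  set x := form2 g N N1.
  have Nx : N = x *: c + N1.
    apply: (frame_mx_ext gU cartan_frame_unit);
      rewrite [RHS]form2Dl form2Zl ?cc.
    - by rewrite gC cN cartan_N_c; ring.
    - by rewrite (gC c) cartan_N_c cartan_N_null /x; ring.
    - by rewrite gNW1 gC cartan_W_c gC cartan_W_N; ring.
  move: NN; rewrite Nx form2Dr !(form2Dl _ (x *: c)).
  rewrite !(form2Zl _ _ c) !(form2Zr _ _ c) cc cartan_N_null (gC c) cartan_N_c.
  by move=> X; rewrite (_ : x = 0) ?scale0r ?add0r //; lra.
split=> //; case: WW => // WE; exfalso.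
have E : frame_mx c N W =
    diag_mx (\row_j [:: 1; 1; -1]`_j) *m frame_mx c N1 W1.
  apply/row_matrixP => i.
  rewrite row_mul row_diag_mx -scalemxAl -rowE !rowK mxE NE WE.
  by case: i => -[|[|[|//]]] lt_i /=; rewrite ?scale1r ?scaleN1r.
have U := phi_frame_unit; move: (congr1 determinant E).
have [P EP dP] := cartan_frameE.
rewrite EQ EP !det_mulmx det_diag !big_ord_recl big_ord0 !mxE /=.
move: U; rewrite unitmxE unitfE => U.
rewrite !mulrA => /(mulIf U) QE.
have := Q0; rewrite QE dP !mul1r !mulr1 mulN1r oppr_gt0 ltNge.
by rewrite invr_ge0 sqrtr_ge0.
Qed.
End TangentSpace.

(** * Derivatives of tensor fields along a curve *)

Section MatrixDerivatives.
Variable R : realType.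

Lemma is_derive_mxP m n (F : R -> 'M[R]_(m, n)) (t : R) (dF : 'M[R]_(m, n)) :
  is_derive t 1 F dF <->
  forall i j, is_derive t 1 (fun s => F s i j) (dF i j).
Proof.
split=> [[DF <-] i j|H].
  rewrite derive_mx // mxE; apply/derivableP.
  exact: (derivable_mxP F t 1).1.
have DF : derivable F t 1.
  by apply/derivable_mxP => i j; have [] := H i j.
apply: (DeriveDef DF); rewrite derive_mx //; apply/matrixP => i j.
by rewrite mxE; have [] := H i j.
Qed.

Lemma is_derive_mulmx m n p (F : R -> 'M[R]_(m, n)) (H : R -> 'M[R]_(n, p))
    (t : R) (dF : 'M[R]_(m, n)) (dH : 'M[R]_(n, p)) :
  is_derive t 1 F dF -> is_derive t 1 H dH ->
  is_derive t 1 (fun s => F s *m H s) (dF *m H t + F t *m dH).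
Proof.
move=> /is_derive_mxP DF /is_derive_mxP DH; apply/is_derive_mxP => i j.
have -> : (fun s => (F s *m H s) i j) =
    \sum_(k < n) ((fun s => F s i k) * (fun s => H s k j)).
  by apply/funext => s; rewrite mxE fct_sumE.
apply: (is_derive_eq (is_derive_sum (fun k => is_deriveM (DF i k) (DH k j)))).
rewrite !mxE -big_split; apply: eq_bigr => k _ /=.
by rewrite /GRing.scale /= addrC [H t k j * _]mulrC.
Qed.

Lemma is_derive_trmx m n (F : R -> 'M[R]_(m, n)) (t : R) (dF : 'M[R]_(m, n)) :
  is_derive t 1 F dF -> is_derive t 1 (fun s => (F s)^T) dF^T.
Proof.
move=> /is_derive_mxP DF; apply/is_derive_mxP => i j.
by rewrite mxE; under eq_fun do rewrite mxE.
Qed.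

Lemma is_derive_form2 n (g : R -> 'M[R]_n) (V W : R -> 'rV[R]_n)
    (t : R) (dg : 'M[R]_n) (dV dW : 'rV[R]_n) :
  is_derive t 1 g dg -> is_derive t 1 V dV -> is_derive t 1 W dW ->
  is_derive t 1 (fun s => form2 (g s) (V s) (W s))
    (form2 dg (V t) (W t) + form2 (g t) dV (W t) + form2 (g t) (V t) dW).
Proof.
move=> Dg DV DW.
have := is_derive_mulmx (is_derive_mulmx DV Dg) (is_derive_trmx DW).
move=> /is_derive_mxP/(_ 0 0) D; apply: (is_derive_eq D).
rewrite /form2 mulmxDl [LHS]mxE [X in X + _ = _]mxE. ring.
Qed.

Lemma is_derive_cst_near (W : normedModType R) (f : R -> W) (t : R) df w :
  (\near t, f t = w) -> is_derive t 1 f df -> df = 0.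
Proof.
move=> fw [_ <-]; rewrite (@near_eq_derive _ _ _ _ (cst w)) //.
exact: derive_cst.
Qed.

Lemma is_derive_comp (V W : normedModType R) (f : R -> V) (h : V -> W) (t : R) :
  differentiable f t -> differentiable h (f t) ->
  is_derive t 1 (h \o f) ('D_('D_1 f t) h (f t)).
Proof.
move=> df dh; have dhf := differentiable_comp df dh.
apply: DeriveDef; first exact: diff_derivable.
by rewrite (deriveE _ dhf) (diff_comp df dh) /= (deriveE _ dh) (deriveE _ df).
Qed.

End MatrixDerivatives.

Section CurveInChart.
Variables (R : realType) (n : nat) (M : smooth_manifold R n).
Variables (I : set R) (C : R -> M).
Hypothesis oI : open I.
Hypothesis smC : smooth_curve I C.

Definition chart_dom (i : midx M) : set R := I `&` C @^-1` mdom i.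

Lemma open_chart_dom i : open (chart_dom i).
Proof.
rewrite openE => t [It Ci]; apply: filterI; first exact: open_nbhs_nbhs.
apply: (smC.1 _ It); apply: open_nbhs_nbhs; split => //; exact: m_dom_open.
Qed.

Let x i := mchart i \o C.

Let x_img i t : chart_dom i t -> (mchart i @` mdom i) (x i t).
Proof. by move=> [_ Ci]; exists (C t). Qed.

Let field_xE T (X : midx M -> M -> T) i t : chart_dom i t ->
  ((X i \o mparam i) \o x i) t = X i (C t).
Proof. by move=> [_ Ci]; rewrite /= /x /= m_chartK. Qed.

Lemma Ck_field_along k l m (X : midx M -> M -> 'M[R]_(l, m)) i :
  smooth_field X -> Ck k (chart_dom i) (fun t => X i (C t)).
Proof.
move=> smX.
have H := @Ck_comp_mx _ _ k _ _ _ _ _ (x i) (X i \o mparam i)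
  (@open_chart_dom i) (@m_img_open _ _ _ i) (@x_img i) (smC.2 i k) (smX i k).
by apply: Ck_eq H => [|t Jt]; [exact: open_chart_dom|exact: field_xE].
Qed.

Lemma Ck_velocity k i : Ck k (chart_dom i) (velocity C i).
Proof. by apply: Ck_derive1; [exact: open_chart_dom|exact: smC.2]. Qed.

(** The chain rule for the representation of a tensor field in a chart. *)
Lemma is_derive_field_along l m (X : midx M -> M -> 'M[R]_(l, m)) i t :
  smooth_field X -> chart_dom i t ->
  is_derive t 1 (fun t => X i (C t)) (dir_der X i (C t) (velocity C i t)).
Proof.
move=> smX Jt.
have Dx : differentiable (x i) t by exact: (smC.2 i 1%N).1.
have DX : differentiable (X i \o mparam i) (x i t).
  by have [+ _] := smX i 1%N; apply; exact: x_img.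
have nX : \near t, (X i \o mparam i \o x i) t = X i (C t).
  apply: filterS (open_nbhs_nbhs (conj (@open_chart_dom i) Jt)) => s Js.
  exact: field_xE.
apply: (near_eq_is_derive nX).
by have := is_derive_comp Dx DX; rewrite -derive1E.
Qed.

Lemma is_derive_velocity i t : chart_dom i t ->
  is_derive t 1 (velocity C i) (derive1 (velocity C i) t).
Proof.
move=> Jt; rewrite derive1E; apply/derivableP/diff_derivable.
by have [+ _] := Ck_velocity 1 i; apply.
Qed.

(** The chain rule for the change of coordinates. *)
Lemma velocity_change i j t : I t -> mdom i (C t) -> mdom j (C t) ->
  velocity C j t = velocity C i t *m jac i j (C t).
Proof.
move=> It Ci Cj.
have Ji : chart_dom i t by split.
have Jj : chart_dom j t by split.
have Dx k : chart_dom k t -> differentiable (x k) t by exact: (smC.2 k 1%N).1.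
have Dij : differentiable (mchart j \o mparam i) (x i t).
  have [+ _] := m_smooth (s := M) i j 1%N; apply.
  by exists (C t).
have nx : \near t, (mchart j \o mparam i \o x i) t = x j t.
  apply: filterS (open_nbhs_nbhs (conj (@open_chart_dom i) Ji)) => s Js.
  exact: (@field_xE _ (fun _ => mchart j)).
have [_ E] := near_eq_is_derive nx (is_derive_comp (Dx _ Ji) Dij).
rewrite /velocity !derive1E -/(x j) -/(x i) E.
exact: deriveEjacobian.
Qed.

Variable G : connection M.

(** The derivative dV of the components is a separate argument, because it is
    more often known by a derivation rule than as a [derive1]. *)
Definition cov (i : midx M) (t : R) (dV V : 'rV[R]_n) : 'rV[R]_n :=
  dV + chr_eval (G i (C t)) (velocity C i t) V.

Lemma cov_derE (V : midx M -> R -> 'rV[R]_n) i (t : R) (dV : 'rV[R]_n) :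
  is_derive t 1 (V i) dV -> cov_der G C V i t = cov i t dV (V i t).
Proof. by move=> [_ <-]; rewrite /cov_der derive1E. Qed.

Lemma covD i t dV dW V W :
  cov i t (dV + dW) (V + W) = cov i t dV V + cov i t dW W.
Proof. by rewrite /cov chr_evalDr addrACA. Qed.

Lemma covZ i t k dV V : cov i t (k *: dV) (k *: V) = k *: cov i t dV V.
Proof. by rewrite /cov chr_evalZr scalerDr. Qed.

(** The Christoffel terms of the two covariant derivatives add up to the
    derivative of the components of g, by compatibility. *)
Lemma is_derive_metric (g : pseudo_metric M) (V W : R -> 'rV[R]_n) i (t : R)
    (dV dW : 'rV[R]_n) :
  metric_compatible g G -> chart_dom i t ->
  is_derive t 1 V dV -> is_derive t 1 W dW ->
  is_derive t 1 (fun s => form2 (g i (C s)) (V s) (W s))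
    (form2 (g i (C t)) (cov i t dV (V t)) (W t) +
     form2 (g i (C t)) (V t) (cov i t dW (W t))).
Proof.
move=> gG Jt DV DW.
have Dg := is_derive_field_along (pm_smooth g) Jt.
apply: (is_derive_eq (is_derive_form2 Dg DV DW)).
rewrite (gG _ _ _ _ _ Jt.2) /cov form2Dl form2Dr; ring.
Qed.

(** The Leibniz rule D (phi V) = phi (D V) + (D phi) V, together with the
    differentiability of phi V. *)
Lemma cov_endo (phi : endo_field M) (V : R -> 'rV[R]_n) i (t : R)
    (dV : 'rV[R]_n) :
  chart_dom i t -> is_derive t 1 V dV ->
  exists2 dPV, is_derive t 1 (fun s => V s *m phi i (C s)) dPV &
    cov i t dPV (V t *m phi i (C t)) =
    cov i t dV (V t) *m phi i (C t)
    + nabla_endo G phi i (C t) (velocity C i t) (V t).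
Proof.
move=> Jt DV.
have Dp := is_derive_field_along (ef_smooth phi) Jt.
exists (dV *m phi i (C t) + V t *m dir_der phi i (C t) (velocity C i t)).
  exact: is_derive_mulmx.
rewrite /cov /nabla_endo mulmxDl.
set u := dV *m _; set v := V t *m _; set w := chr_eval _ _ _; set z := _ *m _.
by apply/rowP => j; rewrite !mxE; ring.
Qed.

End CurveInChart.

(** * The Cartan frame of a slant null curve *)

Section Geometry.
Variables (R : realType) (M : smooth_manifold R 3) (S : acB_metric M).
Variables (G : connection M) (theta : one_form M).

Lemma acB_tangent_at i p : mdom i p ->
  acB_tangent (ac_g S i p) (ac_phi S i p) (ac_eta S i p) (ac_xi S i p).
Proof.
move=> Ci; split; first by move=> x; exact: ac_phi2.
- exact: ac_eta_xi.
- by move=> x y; exact: ac_gphi.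
- exact: pm_sym.
- exact: pm_nondeg.
Qed.

(** The Lee form is known only through bases e_1, e_2, xi with e_1 and e_2 in
    the kernel of eta; a slant null vector provides one. *)
Lemma lee_form_eq0 i p c a b x : lee_form S G theta -> mdom i p ->
  slant_null_vector (ac_g S i p) (ac_phi S i p) (ac_eta S i p) c a b ->
  (forall e e', acF S G i p e e' x = 0) -> form1 (theta i p) x = 0.
Proof.
move=> Hth Ci Hc F0; have H := acB_tangent_at Ci.
pose e (k : 'I_2) := if k == ord0 then c - a *: ac_xi S i p
                     else c *m ac_phi S i p.
rewrite (Hth i p e x Ci).
- by apply: big1 => k _; apply: big1 => l _; rewrite F0 mulr0.
- move=> k; rewrite /e; case: ifP => _; first exact: (eta_sub_xi H Hc).
  exact: (eta_phi H _).
- by rewrite frame_mx_basis; exact: (ker_eta_frame_unit H Hc).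
Qed.

Hypothesis hF1 : F1_manifold S G theta.

Lemma F1_xi_mid i p x z : mdom i p -> acF S G i p x (ac_xi S i p) z = 0.
Proof.
move=> Ci; have H := acB_tangent_at Ci.
rewrite (hF1 x _ z Ci) (phi_xi H) mul0mx !form20r !form10; ring.
Qed.

Lemma F1_xi_right i p x y : mdom i p -> acF S G i p x y (ac_xi S i p) = 0.
Proof.
move=> Ci; have H := acB_tangent_at Ci.
rewrite (hF1 x y _ Ci) (phi_xi H) mul0mx !form20r !form10; ring.
Qed.

Variables (I : set R) (C : R -> M) (a : R) (b : R -> R).
Hypothesis hG : levi_civita (ac_g S) G.
Hypothesis htheta : lee_form S G theta.
Hypothesis oI : open I.
Hypothesis hnull : null_curve (ac_g S) I C.
Hypothesis ha : a <> 0.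
Hypothesis hslant : slant S I C a.
Hypothesis hb : forall t i, I t -> mdom i (C t) ->
  b t = form2 (ac_g S i (C t)) (velocity C i t)
              (velocity C i t *m ac_phi S i (C t)).

Let smC : smooth_curve I C := hnull.1.
Let a0 : a != 0. Proof. exact/eqP. Qed.
Let J i := chart_dom I C i.
Let oJ i : open (J i). Proof. exact: open_chart_dom. Qed.
Let c i t := velocity C i t.
Let xi i t := ac_xi S i (C t).
Let phi i t := ac_phi S i (C t).
Let g i t := form2 (ac_g S i (C t)).
Let th i t := form1 (theta i (C t)).
Let N1 := frame_N1 S C a.
Let W1 := frame_W1 S C a b.

Lemma near_chart_dom i t : J i t -> nbhs t (J i).
Proof. by move=> Jt; apply: open_nbhs_nbhs; split; [exact: oJ|]. Qed.

Lemma slant_null_velocity i t : J i t ->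
  slant_null_vector (ac_g S i (C t)) (phi i t) (ac_eta S i (C t))
    (c i t) a (b t).
Proof.
move=> [It Ci]; split => //.
- by have [_ /(_ t i It Ci)[]] := hnull.
- exact: hslant.
- by rewrite (hb It Ci).
Qed.

Let acB_at i t (Jt : J i t) := acB_tangent_at Jt.2.
Let slant_at i t (Jt : J i t) := slant_null_velocity Jt.

(** All the products of the frame are constant; for each of them the Leibniz
    rule is then a linear equation between covariant derivatives. *)
Lemma metric_cst i t (V W : R -> 'rV[R]_3) dV dW w : J i t ->
  is_derive t 1 V dV -> is_derive t 1 W dW ->
  (forall s, J i s -> g i s (V s) (W s) = w) ->
  g i t (cov C G i t dV (V t)) (W t) + g i t (V t) (cov C G i t dW (W t)) = 0.
Proof.
move=> Jt DV DW VW; have D := is_derive_metric oI smC hG.2 Jt DV DW.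
apply: (is_derive_cst_near (w := w) _ D).
by apply: filterS (near_chart_dom Jt) => s /VW; exact.
Qed.

Let dxi i t : 'rV[R]_3 := dir_der (ac_xi S) i (C t) (c i t).
Let Dxi i t : J i t -> is_derive t 1 (xi i) (dxi i t).
Proof.
by move=> Jt; exact: (is_derive_field_along oI smC (vf_smooth _) Jt).
Qed.

Let dc i t : 'rV[R]_3 := derive1 (c i) t.
Let Dc i t : J i t -> is_derive t 1 (c i) (dc i t).
Proof. by move=> Jt; exact: (is_derive_velocity oI smC Jt). Qed.

(** As phi xi = 0 along the curve, the Leibniz rule and F(c, xi, .) = 0 give
    phi (D xi) = 0, so D xi is a multiple of xi; it is also orthogonal to xi. *)
Lemma cov_xi i t : J i t -> cov C G i t (dxi i t) (xi i t) = 0.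
Proof.
move=> Jt; have H := acB_at Jt.
have [dP DP E] := cov_endo oI smC G (ac_phi S) Jt (Dxi Jt).
have dP0 : dP = 0.
  apply: (is_derive_cst_near (w := 0) _ DP).
  by apply: filterS (near_chart_dom Jt) => s Js; exact: (phi_xi (acB_at Js)).
have nab0 : nabla_endo G (ac_phi S) i (C t) (c i t) (xi i t) = 0.
  by apply: (form2_eq0 (tnondeg H)) => z; exact: (F1_xi_mid _ _ Jt.2).
move: E; rewrite dP0 -/(c i t) nab0 addr0 (phi_xi H).
have -> : cov C G i t 0 0 = 0.
  by rewrite -[X in cov _ _ _ _ X X](scale0r 0) covZ scale0r.
move=> /esym Dp0.
have g0 := metric_cst Jt (Dxi Jt) (Dxi Jt)
  (fun s Js => etrans (g_xi (acB_at Js) _) (teta_xi (acB_at Js))).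
have gC := form2C _ _ (tsym H).
move: g0; rewrite /g [X in _ + X]gC (g_xi H) => g0.
have e0 : form1 (ac_eta S i (C t)) (cov C G i t (dxi i t) (xi i t)) = 0.
  by move: g0; lra.
have := tphi2 H (cov C G i t (dxi i t) (xi i t)).
by rewrite Dp0 mul0mx e0 scale0r addr0 => /esym/eqP; rewrite oppr_eq0 => /eqP.
Qed.

Let Dcc i t := cov C G i t (dc i t) (c i t).

Lemma acc_c i t : J i t -> g i t (Dcc i t) (c i t) = 0.
Proof.
move=> Jt.
have := metric_cst Jt (Dc Jt) (Dc Jt) (fun s Js => tnull (slant_at Js)).
rewrite /g (form2C (c i t) _ (tsym (acB_at Jt))) -/(Dcc i t); lra.
Qed.

Lemma acc_xi i t : J i t -> g i t (Dcc i t) (xi i t) = 0.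
Proof.
move=> Jt.
have := metric_cst Jt (Dc Jt) (Dxi Jt)
  (fun s Js => etrans (g_xi (acB_at Js) _) (tslant (slant_at Js))).
by rewrite (cov_xi Jt) /g form20r addr0.
Qed.

Lemma theta_xi i t : J i t -> th i t (xi i t) = 0.
Proof.
move=> Jt; apply: (lee_form_eq0 htheta Jt.2 (slant_at Jt)) => x y.
exact: (F1_xi_right _ _ Jt.2).
Qed.

Lemma F1_velocity i t : J i t ->
  acF S G i (C t) (c i t) (c i t) (c i t) =
  b t * th i t (c i t *m phi i t) - a ^+ 2 * th i t (c i t).
Proof.
move=> Jt; have H := acB_at Jt; have Hc := slant_at Jt.
have thx := theta_xi Jt.
rewrite (hF1 _ _ _ Jt.2) /= (tphi2 H) (tgphi H) (tnull Hc) (tslant Hc) (tb Hc).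
rewrite form1D form1N form1Z -/(xi i t) -/(th i t) thx.
lra.
Qed.

(** phi is self-adjoint, so the two terms that contain the acceleration are
    equal; the remaining term is F(c, c, c). *)
Lemma is_derive_b i t : J i t ->
  is_derive t 1 b (2 * g i t (Dcc i t) (c i t *m phi i t)
    + b t * th i t (c i t *m phi i t) - a ^+ 2 * th i t (c i t)).
Proof.
move=> Jt; have H := acB_at Jt.
have [dP DP E] := cov_endo oI smC G (ac_phi S) Jt (Dc Jt).
have D := is_derive_metric oI smC hG.2 Jt (Dc Jt) DP.
have nb : \near t, form2 (ac_g S i (C t)) (c i t) (c i t *m phi i t) = b t.
  by apply: filterS (near_chart_dom Jt) => s Js; exact: (tb (slant_at Js)).
apply: (near_eq_is_derive nb); apply: (is_derive_eq D).
rewrite E -/(Dcc i t) form2Dr.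
have -> : form2 (ac_g S i (C t)) (c i t)
    (nabla_endo G (ac_phi S) i (C t) (velocity C i t) (c i t)) =
    acF S G i (C t) (c i t) (c i t) (c i t).
  by rewrite /acF form2C // (tsym H).
have -> : form2 (ac_g S i (C t)) (c i t) (Dcc i t *m ac_phi S i (C t)) =
    g i t (Dcc i t) (c i t *m phi i t).
  by rewrite -(phi_selfadj H) form2C // (tsym H).
rewrite (F1_velocity Jt); rewrite /g /phi; ring.
Qed.

Section CartanFrame.
Hypothesis ode : b_ode S theta I C a b.

(** Comparing the two expressions for b' gives g(D c, phi c), and D c is
    determined by its products with c, xi and phi c. *)
Lemma acceleration i t : J i t -> Dcc i t = W1 i t.
Proof.
move=> Jt; have H := acB_at Jt; have Hc := slant_at Jt.
apply: (frame_mx_ext (tnondeg H) (phi_frame_unit H Hc)).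
- by rewrite (cartan_W_c H Hc); exact: acc_c.
- by rewrite (cartan_W_xi H Hc); exact: acc_xi.
rewrite (cartan_W_phi H Hc).
have [_ E1] := is_derive_b Jt; have [_ E2] := ode Jt.1 Jt.2.
move: E2; rewrite E1 -/(th i t) -/(c i t) -/(phi i t) /g => E2.
have : form2 (ac_g S i (C t)) (Dcc i t) (c i t *m phi i t) =
  2^-1 * (2 / a * Num.sqrt (a ^+ 4 + b t ^+ 2)) by move: E2; lra.
by move=> ->; field.
Qed.

(** Nothing is assumed of b beyond its values, but in each chart these are a
    polynomial in smooth components. *)
Lemma Ck_b k i : Ck k (J i) b.
Proof.
apply: (@Ck_eq _ _ _ k (J i) (fun t => form2 (ac_g S i (C t)) (c i t)
  (c i t *m phi i t))) => [|t Jt|]; [exact: oJ|exact: (tb (slant_at Jt))|].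
apply: Ck_form2; first exact: oJ.
- exact: (Ck_field_along oI smC k i (pm_smooth _)).
- exact: (Ck_velocity oI smC).
- apply: Ck_mulmx; [exact: oJ|exact: (Ck_velocity oI smC)|].
  exact: (Ck_field_along oI smC k i (ef_smooth _)).
Qed.

Lemma Ck_xi k i : Ck k (J i) (xi i).
Proof. exact: (Ck_field_along oI smC k i (vf_smooth _)). Qed.

Lemma smooth_N1 i : smooth_on (J i) (N1 i).
Proof.
move=> k; rewrite /N1 /frame_N1; under eq_fun do rewrite -scaleNr.
apply: CkD; first exact: oJ.
  apply: Ck_scale_mx; [exact: oJ|exact: Ck_cst|exact: Ck_xi].
by apply: Ck_scale_mx; [exact: oJ|exact: Ck_cst|exact: (Ck_velocity oI smC)].
Qed.

Lemma smooth_W1 i : smooth_on (J i) (W1 i).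
Proof.
move=> k; have o := @oJ i.
have cr : Ck k (J i) (@rsqrt R \o (fun t => a ^+ 4 + b t ^+ 2)).
  apply: Ck_rsqrt => //; first by move=> t _; exact: a4b2_gt0.
  apply: CkD => //; first exact: Ck_cst.
  by under eq_fun do rewrite expr2; apply: CkM => //; exact: Ck_b.
have cal : Ck k (J i) (fun t => - (b t / Num.sqrt (a ^+ 4 + b t ^+ 2))).
  by apply: CkN => //; apply: CkM => //; exact: Ck_b.
have cc : Ck k (J i) (c i) by exact: (Ck_velocity oI smC).
have cp : Ck k (J i) (fun t => c i t *m phi i t).
  by apply: Ck_mulmx => //; exact: (Ck_field_along oI smC k i (ef_smooth _)).
have cga : Ck k (J i) (fun t => a / Num.sqrt (a ^+ 4 + b t ^+ 2)).
  by apply: CkM => //; exact: Ck_cst.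
have cam : Ck k (J i) (fun t => - (- (b t / Num.sqrt (a ^+ 4 + b t ^+ 2)) / a)).
  by apply: CkN => //; apply: CkM => //; exact: Ck_cst.
rewrite /W1 /frame_W1 /=; under eq_fun do rewrite -(scaleNr _ (velocity C i _)).
have cx := @Ck_xi k i.
apply: (CkD o (CkD o (Ck_scale_mx o cal cx) _) (Ck_scale_mx o cga cp)).
exact: (Ck_scale_mx o cam cc).
Qed.

Lemma field_along_N1 : field_along I C N1.
Proof.
split=> [|i j t It Ci Cj]; first exact: smooth_N1.
rewrite /N1 /frame_N1 (vf_change _ Ci Cj) (velocity_change oI smC It Ci Cj).
by rewrite mulmxBl -!scalemxAl.
Qed.

Lemma field_along_W1 : field_along I C W1.
Proof.
split=> [|i j t It Ci Cj]; first exact: smooth_W1.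
rewrite /W1 /frame_W1 (vf_change _ Ci Cj) (velocity_change oI smC It Ci Cj).
by rewrite mulmxDl mulmxBl -!scalemxAl -!mulmxA (ef_change _ Ci Cj).
Qed.

Lemma general_frenet_frame_N1W1 : general_frenet_frame (ac_g S) I C N1 W1.
Proof.
split; [exact: field_along_N1|exact: field_along_W1|move=> t i It Ci].
have Jt : J i t by []; have H := acB_at Jt; have Hc := slant_at Jt.
have gC := form2C _ _ (tsym H).
rewrite /= frame_mx_basis; split; first exact: (cartan_frame_unit H Hc).
split.
- by rewrite gC; exact: (cartan_N_c H Hc).
- exact: (cartan_W_unit H Hc).
- exact: (cartan_N_null H Hc).
- by rewrite gC; exact: (cartan_W_N H Hc).
- by rewrite gC; exact: (cartan_W_c H Hc).
Qed.

Lemma same_orientation_N1W1 : same_orientation S I C N1 W1.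
Proof.
move=> t i It Ci; have Jt : J i t by [].
exact: (cartan_frame_orientation _ (slant_at Jt)).
Qed.

Lemma cov_c i t : J i t -> cov_der G C c i t = W1 i t.
Proof. by move=> Jt; rewrite (cov_derE C G (Dc Jt)); exact: acceleration. Qed.

(** N1 is a combination of xi and c with constant coefficients, and xi is
    parallel. *)
Lemma cov_N1 i t : J i t -> cov_der G C N1 i t = - (2 * a ^+ 2)^-1 *: W1 i t.
Proof.
move=> Jt; pose dN := a^-1 *: dxi i t + (- (2 * a ^+ 2)^-1) *: dc i t.
have N1E : N1 i = fun s => a^-1 *: xi i s + (- (2 * a ^+ 2)^-1) *: c i s.
  by apply/funext => s; rewrite scaleNr.
have DN : is_derive t 1 (N1 i) dN.
  rewrite N1E; have Dx := Dxi Jt; have Dc' := Dc Jt.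
  exact: (is_deriveD (is_deriveZ _ Dx) (is_deriveZ _ Dc')).
rewrite (cov_derE C G DN) /dN N1E covD !covZ (cov_xi Jt) scaler0 add0r.
by congr (_ *: _); exact: acceleration.
Qed.

(** The derivatives of the constants g(W1, W1), g(W1, c) and g(W1, N1) give the
    products of D W1 with the three vectors of the frame. *)
Lemma cov_W1 i t : J i t ->
  cov_der G C W1 i t = (2 * a ^+ 2)^-1 *: c i t - N1 i t.
Proof.
move=> Jt; have H := acB_at Jt; have Hc := slant_at Jt.
have gC := form2C _ _ (tsym H).
have DW : is_derive t 1 (W1 i) (derive1 (W1 i) t).
  rewrite derive1E; apply/derivableP/diff_derivable.
  by have [+ _] := smooth_W1 i 1%N; apply.
have [DN eN] : derivable (N1 i) t 1 /\ cov C G i t (derive1 (N1 i) t) (N1 i t) =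
     - (2 * a ^+ 2)^-1 *: W1 i t.
  split; last exact: cov_N1.
  by apply/diff_derivable; have [+ _] := smooth_N1 i 1%N; apply.
have {}DN : is_derive t 1 (N1 i) (derive1 (N1 i) t).
  by rewrite derive1E; apply/derivableP.
have WW := metric_cst Jt DW DW
  (fun s Js => cartan_W_unit (acB_at Js) (slant_at Js)).
have Wc := metric_cst Jt DW (Dc Jt)
  (fun s Js => cartan_W_c (acB_at Js) (slant_at Js)).
have WN := metric_cst Jt DW DN
  (fun s Js => cartan_W_N (acB_at Js) (slant_at Js)).
rewrite (cov_derE C G DW).
set D := cov _ _ _ _ _ _ in WW Wc WN *.
have w1 := cartan_W_unit H Hc; have w2 := cartan_W_c H Hc.
have w3 := cartan_W_N H Hc.
have n1 := cartan_N_c H Hc; have n2 := cartan_N_null H Hc; have c1 := tnull Hc.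
apply: (frame_mx_ext (tnondeg H) (cartan_frame_unit H Hc));
  rewrite [RHS]form2Dl form2Zl form2Nl.
- move: Wc; rewrite -/(Dcc i t) (acceleration Jt) /g w1 c1 n1; lra.
- move: WN; rewrite eN /g form2Zr w1 n2 (gC (c i t)) n1; lra.
- move: WW; rewrite /g (gC (W1 i t) D) (gC (c i t)) w2 (gC (N1 i t)) w3; lra.
Qed.

Lemma frenet_functions_N1W1 : frenet_functions G I C N1 W1 (fun=> 0) (fun=> 1)
  (fun=> - (2 * a ^+ 2)^-1).
Proof.
move=> t i It Ci; have Jt : J i t by [].
rewrite [cov_der _ _ _ _ _ in X in [/\ X, _ & _]](cov_c Jt).
rewrite (cov_N1 Jt) (cov_W1 Jt) scale0r scale1r add0r.
by rewrite oppr0 scale0r add0r scale1r opprK.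
Qed.

Lemma distinguished_N1W1 : distinguished G I C N1 W1.
Proof. by do 3 eexists; split; first exact: frenet_functions_N1W1. Qed.

Lemma non_geodesic_N1W1 : non_geodesic G I C N1 W1.
Proof.
do 3 eexists; split; first exact: frenet_functions_N1W1.
by move=> t _ /eqP; rewrite oner_eq0.
Qed.

Lemma cartan_framed_N1W1 :
  cartan_framed (ac_g S) G I C N1 W1 (fun=> - (2 * a ^+ 2)^-1).
Proof.
split=> [|t i It Ci]; first exact: general_frenet_frame_N1W1.
have Jt : J i t by [].
by rewrite (cov_N1 Jt) (cov_W1 Jt) opprK; split=> //; exact: cov_c.
Qed.

(** With h = 0 the acceleration W1 is k1 W, and both vectors have unit
    square. *)
Lemma frenet_frame_unique N W : general_frenet_frame (ac_g S) I C N W ->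
  same_orientation S I C N W -> distinguished G I C N W ->
  forall t i, I t -> mdom i (C t) -> N i t = N1 i t /\ W i t = W1 i t.
Proof.
move=> [_ _ F] O [h [k1 [k2 [K h0]]]] t i It Ci.
have Jt : J i t by []; have H := acB_at Jt; have Hc := slant_at Jt.
have [_ [cN WW NN NW _]] := F t i It Ci.
apply: (cartan_frame_unique H Hc _ cN NN NW (O t i It Ci)).
have [+ _ _] := K t i It Ci.
rewrite (h0 _ It) scale0r add0r => E.
have {}E : W1 i t = k1 t *: W i t by rewrite -E; exact/esym/cov_c.
have : k1 t ^+ 2 = 1.
  rewrite -(cartan_W_unit H Hc) -[cartan_W _ _ _ _ _]/(W1 i t) E.
  rewrite form2Zl form2Zr WW; ring.
move=> /eqP; rewrite sqrf_eq1 => /orP[]/eqP k1E; rewrite k1E in E; [left|right].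
  by rewrite -[LHS]scale1r -E.
by rewrite -[cartan_W _ _ _ _ _]/(W1 i t) E scaleN1r opprK.
Qed.

End CartanFrame.

(** The Lee form is a contraction of F, so its two terms disappear. *)
Lemma b_ode_F0 : F0_manifold S G ->
  (b_ode S theta I C a b <->
   forall t, I t ->
     is_derive t 1 b (2 / a * Num.sqrt (a ^+ 4 + b t ^+ 2))).
Proof.
move=> F0.
have th0 i t x : J i t -> form1 (theta i (C t)) x = 0.
  move=> Jt; apply: (lee_form_eq0 htheta Jt.2 (slant_at Jt)) => y z.
  exact: F0 Jt.2.
have E i t x y : J i t -> b t * form1 (theta i (C t)) x
    - a ^+ 2 * form1 (theta i (C t)) y + 2 / a * Num.sqrt (a ^+ 4 + b t ^+ 2) =
    2 / a * Num.sqrt (a ^+ 4 + b t ^+ 2).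
  by move=> Jt; rewrite !th0 // !mulr0 subr0 add0r.
split=> [D t It|D t i It Ci].
  have [i Ci] := m_cover (C t); have := D t i It Ci.
  by rewrite E //; split.
by rewrite E; [exact: D|split].
Qed.
End Geometry.

Unset Implicit Arguments.

Theorem theorem3p7 (R : realType) (M : smooth_manifold R 3)
    (S : acB_metric M) (G : connection M) (theta : one_form M)
    (hG : levi_civita (ac_g S) G)
    (htheta : lee_form S G theta)
    (hF1 : F1_manifold S G theta)
    (I : set R) (hIopen : open I) (hIitv : is_interval I)
    (C : R -> M) (hnull : null_curve (ac_g S) I C)
    (a : R) (ha : a <> 0) (hslant : slant S I C a)
    (b : R -> R)
    (hb : forall t i, I t -> mdom i (C t) ->
      b t = form2 (ac_g S i (C t)) (velocity C i t)
                  (velocity C i t *m ac_phi S i (C t))) :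
  (b_ode S theta I C a b ->
     let N1 := frame_N1 S C a in
     let W1 := frame_W1 S C a b in
     [/\ general_frenet_frame (ac_g S) I C N1 W1,
         same_orientation S I C N1 W1 &
         distinguished G I C N1 W1] /\
     (forall N W : midx M -> R -> 'rV[R]_3,
        general_frenet_frame (ac_g S) I C N W ->
        same_orientation S I C N W ->
        distinguished G I C N W ->
        forall t i, I t -> mdom i (C t) -> N i t = N1 i t /\ W i t = W1 i t) /\
     non_geodesic G I C N1 W1 /\
     cartan_framed (ac_g S) G I C N1 W1 (fun=> - (2 * a ^+ 2)^-1)) /\
  (F0_manifold S G ->
     (b_ode S theta I C a b <->
      exists u : R, forall t, I t ->
        b t = 2^-1 * (expR (2 * (t + u) / a)
                      - a ^+ 4 * expR (- (2 * (t + u) / a))))).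
Proof.
have a0 : a != 0 by exact/eqP.
split=> [ode N1 W1|F0]; last first.
  apply: (iff_trans (b_ode_F0 htheta hnull ha hslant hb F0)).
  exact: sinh_ode_sol.
split; last split; last split.
- split; first exact: (general_frenet_frame_N1W1 hIopen hnull ha hslant hb).
    exact: (same_orientation_N1W1 hnull ha hslant hb).
  exact: (distinguished_N1W1 hF1 hG htheta hIopen hnull ha hslant hb ode).
- exact: (frenet_frame_unique hF1 hG htheta hIopen hnull ha hslant hb ode).
- exact: (non_geodesic_N1W1 hF1 hG htheta hIopen hnull ha hslant hb ode).
- exact: (cartan_framed_N1W1 hF1 hG htheta hIopen hnull ha hslant hb ode).
Qed.
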